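(* Let $\mathbb{F}$ be a field of characteristic zero, $q\in\mathbb{F}$ nonzero and not a root of unity, and let $T(n,k)$ be a bivariate $q$-hypergeometric term. Let $T_1,T_2$ be two similar bivariate $q$-hypergeometric terms such that $$T(n,k)=T_1(n,k+1)-T_1(n,k)+T_2(n,k)\quad\text{for all }n,k\ge 0,$$ and such that $T_2$ has a $q$-normal representation $(r,s,u,v)$ with respect to $K$ with $v$ $\varepsilon_y$-free. Then $T$ has a $qZ$-pair if and only if $T_2$ is a $q$-proper hypergeometric term, or equivalently, if and only if $v(x,y)$ is a $q$-proper polynomial.
   Context: A function $T:\mathbb{N}^2\to\mathbb{F}$ is a bivariate $q$-hypergeometric term if there exist $R_1,R_2\in\mathbb{F}(x,y)$ with $T(n+1,k)=R_1(q^n,q^k)T(n,k)$ and $T(n,k+1)=R_2(q^n,q^k)T(n,k)$; standing convention: these hold for all $n,k\ge0$ and $R_1(q^n,q^k),R_2(q^n,q^k)$ are defined and nonzero for all $n,k\ge0$. Two such terms $T_1,T_2$ are similar if $T_1(n,k)/T_2(n,k)=R(q^n,q^k)$ for some $R\in\mathbb{F}(x,y)$. $N,K$ are the shifts in $n$ and $k$. A $q$-normal representation of a term with respect to $K$ is a tuple $r,s,u,v\in\mathbb{F}[x,y]$ with $R_2=\frac{r}{s}\cdot\frac{u(x,qy)/v(x,qy)}{u(x,y)/v(x,y)}$ such that, viewed as polynomials in $y$ over $\mathbb{F}(x)$, $u,v$ are coprime and not divisible by $y$, and $r(x,y)$, $s(x,q^hy)$ are coprime for all $h\in\mathbb{Z}$;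 with respect to $N$ it is defined analogously from $R_1$, with the roles of $x$ and $y$ exchanged. $v$ is $\varepsilon_y$-free if for every nonzero integer $m$, $v(x,y)$ and $v(x,q^my)$ share no irreducible factor of positive degree in $y$ other than $y$. A nonzero $f\in\mathbb{F}[x,y]$ is $q$-proper if each irreducible factor $p$ of $f$ satisfies $p(x,y)\mid p(q^ax,q^by)$ for some integers $a,b$ not both zero; a bivariate $q$-hypergeometric term is $q$-proper if the fourth component $v$ of a $q$-normal representation of it with respect to $N$ or $K$ is a $q$-proper polynomial. A $qZ$-pair for $T$ is $(L,G)$ with $L=\sum_{i=0}^I a_i(q^n)N^i$, $a_i\in\mathbb{F}[x]$ not all zero, and $G$ a bivariate $q$-hypergeometric term, such that $LT(n,k)=G(n,k+1)-G(n,k)$ for all $n,k\ge0$.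
   Formalization: In a qZ-pair, G need only satisfy its two recurrences wherever its nonzero rational ratios are defined; the convention that the ratios are defined and nonzero at all (q^n,q^k) is not imposed on G, since with it the claim fails, e.g. T=Δ_k[(q^k−q^5)(2q^n)^k], q=3. *)

(* Defs.v *)
From HB Require Import structures.
From mathcomp Require Import all_boot all_order all_algebra.

Set Implicit Arguments.
Unset Strict Implicit.
Unset Printing Implicit Defensive.

Import GRing.Theory.
Local Open Scope ring_scope.

(* F[x,y] is {poly {poly F}}: the outer variable 'X is y, and the variable of
   the coefficient ring, 'X%:P, is x. *)
Notation bipoly F := {poly {poly F}}.
Notation birat F := {fraction {poly {poly F}}}.
Notation "p %:FF" := (@FracField.tofrac _ p) (at level 2, format "p %:FF").

Section QHypergeometric.

Variable F : fieldType.
Implicit Types (a b c : F) (p f r s u v : bipoly F) (R : birat F).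
Implicit Types (T G : nat -> nat -> F).

(* p(a, b), with x = a and y = b *)
Definition bieval p a b : F := p.[b%:P].[a].

(* p(a x, b y) *)
Definition biscale a b p : bipoly F :=
  map_poly (comp_poly (a *: 'X)) p \Po (b%:P *: 'X).

(* p as a polynomial in y over the field F(x) *)
Definition polyFx p : {poly {fraction {poly F}}} :=
  map_poly (@FracField.tofrac {poly F}) p.

(* Divisibility in the ring F[x,y]; the library's %| on {poly {poly F}} is
   pseudo-divisibility, which ignores factors in F[x]. *)
Definition bidvd p f : Prop := exists g : bipoly F, f = g * p.

Definition biirreducible p : Prop :=
  [/\ p != 0, p \isn't a GRing.unit
    & forall f g : bipoly F, p = f * g ->
        f \is a GRing.unit \/ g \is a GRing.unit].

(* R is defined at (a, b), with value c *)
Definition value_at R a b c : Prop :=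
  exists f g : bipoly F,
    [/\ R = f%:FF / g%:FF, bieval g a b != 0
      & c = bieval f a b / bieval g a b].

Variable q : F.

Definition qratios T (R1 R2 : birat F) : Prop :=
  [/\ R1 != 0, R2 != 0,
      forall n k c, value_at R1 (q ^+ n) (q ^+ k) c -> T n.+1 k = c * T n k
    & forall n k c, value_at R2 (q ^+ n) (q ^+ k) c -> T n k.+1 = c * T n k].

Definition qregular R : Prop :=
  forall n k, exists2 c, value_at R (q ^+ n) (q ^+ k) c & c != 0.

(* With the convention that both ratios are defined and nonzero at every
   (q^n, q^k), so that the two recurrences hold for all n and k. *)
Definition qhyper_with T (R1 R2 : birat F) : Prop :=
  [/\ qratios T R1 R2, qregular R1 & qregular R2].

Definition qhyper T : Prop := exists R1 R2, qhyper_with T R1 R2.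

(* No convention on zeros and poles of the ratios: a nonzero multiple
   R(q^n, q^k) T(n, k) of a term T may vanish at some (n, k). *)
Definition qhyper_generic G : Prop := exists R1 R2, qratios G R1 R2.

Definition qsimilar (T1 T2 : nat -> nat -> F) : Prop :=
  exists R, forall n k,
    T2 n k != 0 /\ value_at R (q ^+ n) (q ^+ k) (T1 n k / T2 n k).

Definition qnormal_y r s u v : Prop :=
  [/\ coprimep (polyFx u) (polyFx v),
      ~~ ('X %| polyFx u), ~~ ('X %| polyFx v)
    & forall h : int, coprimep (polyFx r) (polyFx (biscale 1 (q ^ h) s))].

Definition qnormal_repK T r s u v : Prop :=
  exists R1 R2,
    [/\ qhyper_with T R1 R2, s != 0, u != 0, v != 0
      & R2 = (r%:FF / s%:FF)
             * (((biscale 1 q u)%:FF / (biscale 1 q v)%:FF)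
                / (u%:FF / v%:FF))]
    /\ qnormal_y r s u v.

Definition qnormal_repN T r s u v : Prop :=
  exists R1 R2,
    [/\ qhyper_with T R1 R2, s != 0, u != 0, v != 0
      & R1 = (r%:FF / s%:FF)
             * (((biscale q 1 u)%:FF / (biscale q 1 v)%:FF)
                / (u%:FF / v%:FF))]
    /\ qnormal_y (swapXY r) (swapXY s) (swapXY u) (swapXY v).

(* An irreducible p equals y up to a unit of F[x,y] iff p = c y with c in F. *)
Definition eps_y_free v : Prop :=
  forall m : int, m != 0 ->
  forall p, biirreducible p -> (1 < size p)%N ->
    bidvd p v -> bidvd p (biscale 1 (q ^ m) v) ->
    exists c, p = c%:P%:P * 'X.

Definition qproper_poly f : Prop :=
  f != 0 /\
  forall p, biirreducible p -> bidvd p f ->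
    exists a b : int,
      (a, b) != (0, 0) /\ bidvd p (biscale (q ^ a) (q ^ b) p).

Definition qproper_term T : Prop :=
  exists r s u v,
    (qnormal_repN T r s u v \/ qnormal_repK T r s u v) /\ qproper_poly v.

(* G ranges over qhyper_generic, not qhyper: given T, the term G is determined
   up to a function of n alone, and it can vanish at some (n, k) although T
   does not. *)
Definition qZ_pair T (I : nat) (a : 'I_I.+1 -> {poly F}) G : Prop :=
  [/\ exists i, a i != 0,
      qhyper_generic G
    & forall n k,
        \sum_(i < I.+1) (a i).[q ^+ n] * T (n + i)%N k = G n k.+1 - G n k].

Definition has_qZ_pair T : Prop :=
  exists (I : nat) (a : 'I_I.+1 -> {poly F}) G, qZ_pair T a G.

End QHypergeometric.

(* Main.v *)
From HB Require Import structures.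
Require Import Defs.
From mathcomp Require Import all_boot all_order all_algebra.
From mathcomp Require Import boolp zify ring.
Set Implicit Arguments.
Unset Strict Implicit.
Unset Printing Implicit Defensive.
Import Order.TTheory GRing.Theory Num.Theory.
Local Open Scope ring_scope.

(** Let p be an irreducible polynomial such that no nontrivial shift
p(q^a x, q^b y) is divisible by p. On the orbit of p under Z^2, multiplicities of
factors are finitely supported functions on Z^2, and the compatibility of the two
shift quotients of T2 makes them a cocycle. Its row sums vanish, which forces
r and s to have no factor in the orbit, so that up to units T2 behaves there like
the rational function u / v.

If v has such a factor p and L T2 = (K - 1)(Z T2), consider a row of the orbit
which meets the last pole of L (u / v). Since v is epsilon_y-free, there is
exactly one pole of L (u / v) on that row. But with X = Z u / v this function is
(r / s) X(x, q y) - X(x, y), whose poles on the row include both ends of the pole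
set of X: either none or at least two.

Conversely, if v is q-proper then so is s. For a q-proper f, the shifts
f(q^i x, q^j y) with i <= I and j <= J have a common multiple of y-degree linear in
I + J, so the (I + 1)(J + 1) quotients T2(n + i, k + j) / T2(n, k) are linearly
dependent over F(x) for I, J large. Dividing the resulting k-free recurrence by
K - 1 yields a qZ-pair for T2, hence for T.

The rational functions involved are handled through their values at the points
(q^n, q^k), which are Zariski dense. *)

(** * Factorization in F[x, y] *)

(** Two obstacles shape the proof. Polynomials occurring as denominators may vanish at grid points,
    where a quotient of polynomials determines nothing. Relations are therefore proved after
    multiplication by a polynomial, and that factor is cancelled by density, on the condition that
    the function at hand is represented near each grid point by a fraction defined there. Moreover
    [%|] on F[x][y] is divisibility over F(x), so divisibility in F[x, y] has to be recovered
    through Gauss's lemma; in the orbit argument irreducible polynomials in [x] alone drop out,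
    being fixed by scaling [y]. The passage between T and T2 rests on similarity: a telescoper
    applied to T1 gives a rational multiple of T2. The G of a given pair is not assumed to be such a
    multiple. It becomes one because (K - 1) G is a rational multiple of G, except when this
    multiple is zero, where L T = 0 and G can be replaced by 0. *)

HB.lock Definition bimult (F : fieldType) (p f : {poly {poly F}}) : nat :=
  \max_(m < size f | `[< bidvd (p ^+ m) f >]) m.

Section Factorization.
Variable F : fieldType.
Implicit Types (c d : {poly F}) (e f g h p : {poly {poly F}}).

(* Instances of size_mul whose sizes are syntactically those of the goals, for lia. *)
Lemma size_mulF c d : c != 0 -> d != 0 -> size (c * d) = (size c + size d).-1.
Proof. exact: size_mul. Qed.

Lemma size_mulFF f g : f != 0 -> g != 0 -> size (f * g) = (size f + size g).-1.
Proof. exact: size_mul. Qed.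

Lemma bidvd_refl f : bidvd f f.
Proof. by exists 1; rewrite mul1r. Qed.

Lemma bidvd_mulr f g h : bidvd f g -> bidvd f (g * h).
Proof. by move=> [a ->]; exists (a * h); rewrite mulrAC. Qed.

Lemma bidvd_mull f g h : bidvd f g -> bidvd f (h * g).
Proof. by rewrite mulrC; apply: bidvd_mulr. Qed.

Lemma bidvd_dvdp f g : bidvd f g -> f %| g.
Proof. by move=> [a ->]; apply: dvdp_mull. Qed.

Lemma bidvd_polyCP c f : bidvd c%:P f <-> forall i, c %| f`_i.
Proof.
split=> [[g ->] i|cf]; first by rewrite coefMC dvdp_mull.
exists (\poly_(i < size f) (f`_i %/ c)); apply/polyP => i.
rewrite coefMC coef_poly; case: ltnP => [_|lei]; first by rewrite divpK.
by rewrite mul0r nth_default.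
Qed.

Lemma irredp_dvdM c d d' : irreducible_poly c -> c %| d * d' -> c %| d \/ c %| d'.
Proof.
move=> [_ irr_c] cdd; have [|ncd] := boolP (c %| d); first by left.
right; rewrite -(Gauss_dvdpr _ (q := d)) // /coprimep.
apply: contraNT ncd => /irr_c/(_ (dvdp_gcdl _ _)) eq_c.
by rewrite -(eqp_dvdl _ eq_c) dvdp_gcdr.
Qed.

Lemma irredp_factor c : (1 < size c)%N -> exists2 d : {poly F}, irreducible_poly d & d %| c.
Proof.
elim: (size c) {-2}c (leqnn (size c)) => [|m IH] {}c lecm ltc; first by lia.
have [irr_c|red_c] := EM (irreducible_poly c); first by exists c.
have [d [ltd dc neq]] : exists d, [/\ size d != 1%N, d %| c & ~~ (d %= c)].
  apply: contrapT => h; apply: red_c; split=> // d szd dc.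
  by apply: contrapT => /negP neq; apply: h; exists d.
have c0 : c != 0 by rewrite -size_poly_gt0; lia.
have d0 : d != 0 by apply: contraTneq dc => ->; rewrite dvd0p.
have := dvdp_leq c0 dc; have := dvdp_size_eqp dc.
rewrite (negPf neq) => /negbT szdc ledc.
have szd : (0 < size d)%N by rewrite size_poly_gt0.
have ltdc : (size d < size c)%N by rewrite ltn_neqAle szdc.
have [||d' irr_d d'd] := IH d.
- by rewrite -ltnS (leq_trans ltdc).
- by rewrite ltn_neqAle eq_sym ltd.
by exists d' => //; apply: dvdp_trans dc.
Qed.

(** Gauss's lemma: if [i] and [j] are the least indices of coefficients of [f] and [g] not divisible
    by [c], the coefficient [i + j] of [f * g] is congruent to their product modulo [c]. *)
Lemma irredp_bidvdM c f g : irreducible_poly c ->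
  bidvd c%:P (f * g) -> bidvd c%:P f \/ bidvd c%:P g.
Proof.
move=> irr_c /bidvd_polyCP cfg; apply: contrapT => /not_orP[nf ng].
have ex h : ~ bidvd c%:P h -> exists i, ~~ (c %| h`_i).
  move=> nh; apply: contrapT => ex; apply/nh/bidvd_polyCP => i.
  by apply/negPn/negP => ni; apply: ex; exists i.
case: (ex_minnP (ex f nf)) => i ni mini; case: (ex_minnP (ex g ng)) => j nj minj.
have := cfg (i + j)%N; have ltij : (i < (i + j).+1)%N by lia.
rewrite coefM (bigD1 (Ordinal ltij)) //= addKn dvdp_addl; last first.
  apply: (big_ind (fun x => c %| x)) => [|x y dx dy|k nk]; [exact: dvdp0|exact: dvdp_add|].
  have [lt_ki|le_ik] := ltnP k i.
    by apply/dvdp_mulr/negPn/negP => /mini; rewrite leqNgt lt_ki.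
  apply/dvdp_mull/negPn/negP => /minj le_j.
  have neq_k : nat_of_ord k != i by apply: contraNneq nk => eqk; apply/eqP/val_inj.
  have lt_k := ltn_ord k; lia.
by move=> /(irredp_dvdM irr_c)[]; apply/negP.
Qed.

Definition primitive f := forall c : {poly F}, irreducible_poly c -> ~ bidvd c%:P f.

(** The irreducible factors of [c] are removed one at a time: by Gauss's lemma each divides the
    cofactor or [p], and primitivity excludes [p]. *)
Lemma primitive_bidvd p c g : primitive p -> c != 0 -> bidvd p (c%:P * g) -> bidvd p g.
Proof.
move=> prim_p; elim: (size c) {-2}c (leqnn (size c)) => [|m IH] {}c lecm c0.
  by move: lecm; rewrite leqn0 size_poly_eq0 (negPf c0).
have [sz1|szn1] := eqVneq (size c) 1%N.
  case/eqP/size_poly1P: sz1 => k k0 -> [h cgh]; exists (k^-1%:P%:P * h).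
  by rewrite -mulrA -cgh mulrA -!polyCM mulVf // mul1r.
have szc : (0 < size c)%N by rewrite size_poly_gt0.
have [|d irr_d /dvdpP[c' def_c]] := @irredp_factor c; first lia.
move=> [h cgh]; move: cgh; rewrite def_c polyCM => cgh.
have d0 : d != 0 by apply: irredp_neq0.
have c'0 : c' != 0 by apply: contraNneq c0 => c'0; rewrite def_c c'0 mul0r.
have [|[h' def_h]|//] := @irredp_bidvdM d h p irr_d; last 1 first.
- by move/(prim_p d irr_d).
- by rewrite -cgh mulrAC; exists (c'%:P * g).
apply: (IH c') => //.
  have := size_mulF c'0 d0; rewrite -def_c; have lt1 : (1 < size d)%N by case: irr_d.
  lia.
exists h'; have dP0 : d%:P != 0 by rewrite polyC_eq0.
by apply: (mulIf dP0); rewrite mulrAC cgh def_h mulrAC.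
Qed.

(** Bridge from divisibility over F(x) to divisibility in F[x, y]. *)
Lemma primitive_dvdp p f : primitive p -> p %| f -> bidvd p f.
Proof.
move=> prim_p /Pdiv.Idomain.dvdpP[[c h] /= c0 cfh].
by apply: (primitive_bidvd prim_p c0); exists h; rewrite mul_polyC.
Qed.

(** Each irreducible factor extracted lowers the x-degree of the leading coefficient. *)
Lemma primitive_part f : f != 0 ->
  exists2 c, c != 0 & exists2 g, f = c%:P * g & primitive g.
Proof.
elim: (size (lead_coef f)) {-2}f (leqnn (size (lead_coef f))) => [|m IH] {}f lem f0.
  by move: lem; rewrite leqn0 size_poly_eq0 lead_coef_eq0 (negPf f0).
have [prim_f|] := EM (primitive f).
  by exists 1; rewrite ?oner_neq0 //; exists f; rewrite ?mul1r.
move/existsNP=> [d /not_implyP[irr_d /contrapT [g def_f]]].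
have g0 : g != 0 by apply: contraNneq f0 => g0; rewrite def_f g0 mul0r.
have d0 : d != 0 by apply: irredp_neq0.
have [||c c0 [g' def_g prim_g]] := IH g; [|by []|].
  have aux a b : (1 < b -> (a + b).-1 <= m.+1 -> a <= m)%N by lia.
  apply: (aux _ (size d)); first by case: irr_d.
  by move: lem; rewrite def_f lead_coefM lead_coefC size_mulF ?lead_coef_eq0.
exists (c * d); first by rewrite mulf_neq0.
by exists g'; rewrite // def_f def_g polyCM mulrAC.
Qed.

Lemma biunitP f : reflect (exists2 k : F, k != 0 & f = k%:P%:P) (f \is a GRing.unit).
Proof.
rewrite poly_unitE; apply: (iffP andP) => [[/eqP sz1]|[k k0 ->]].
  rewrite poly_unitE => /andP[/eqP sz1' u]; exists f`_0`_0.
    by rewrite -unitfE.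
  by rewrite -[(f`_0`_0)%:P]size1_polyC ?sz1' // -size1_polyC ?sz1.
rewrite size_polyC polyC_eq0 k0 coefC /= poly_unitE size_polyC k0 coefC /= unitfE.
by rewrite k0.
Qed.

(** Positive degree in [y] makes an irreducible polynomial primitive, so that for it as a divisor
    [%|] and [bidvd] agree. *)
Definition biprime p := biirreducible p /\ (1 < size p)%N.

Lemma biprime_neq0 p : biprime p -> p != 0.
Proof. by case=> [[]]. Qed.

Lemma biprime_primitive p : biprime p -> primitive p.
Proof.
move=> [[p0 _ irr_p] ltp] d irr_d [g def_p]; have lt1 : (1 < size d)%N by case: irr_d.
have := irr_p _ _ def_p => -[] /biunitP[k k0 def].
  move: ltp; rewrite def_p def -polyCM size_polyC; by case: (_ != _).
by move: lt1; move/polyC_inj: def => ->; rewrite size_polyC k0.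
Qed.

(** If [p] and [f] are not coprime over F(x), the primitive part of their gcd has positive y-degree
    and divides [p], hence is associated to [p]. *)
Lemma biprime_bidvdM p f g : biprime p -> bidvd p (f * g) -> bidvd p f \/ bidvd p g.
Proof.
move=> pr_p /bidvd_dvdp pfg; have prim_p := biprime_primitive pr_p.
have [[p0 np irr_p] ltp] := pr_p.
have [cop|ncop] := boolP (coprimep p f).
  by right; apply: primitive_dvdp; rewrite // -(Gauss_dvdpr _ cop).
left; apply: primitive_dvdp => //.
have d0 : gcdp p f != 0 by rewrite gcdp_eq0 (negPf p0).
have [c c0 [g' def_d prim_g]] := primitive_part d0.
have eq_d : gcdp p f %= g'.
  by rewrite def_d mul_polyC; apply: eqp_scale.
have [|e def_p] := @primitive_dvdp g' p prim_g.
  by rewrite -(eqp_dvdl _ eq_d) dvdp_gcdl.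
have : size g' != 1%N by rewrite -(eqp_size eq_d).
have /irr_p[] := def_p; last first.
  by case/biunitP=> k k0 ->; rewrite size_polyC polyC_eq0 k0.
case/biunitP=> k k0 def_e _; apply: dvdp_trans (dvdp_gcdr p f).
by rewrite (eqp_dvdr _ eq_d) def_p def_e mul_polyC dvdpZl ?polyC_eq0 ?dvdpp.
Qed.

(** The induction is on the y-degree plus the x-degree of the leading coefficient: this is additive
    on nonzero products and vanishes only at units. *)
Lemma bifactor_ind (P : {poly {poly F}} -> Prop) :
    (forall f, f \is a GRing.unit -> P f) ->
    (forall f g, f != 0 -> g != 0 -> P f -> P g -> P (f * g)) ->
  forall f, f != 0 -> (forall p, biirreducible p -> bidvd p f -> P p) -> P f.
Proof.
move=> Pu PM f; pose m f := ((size f).-1 + (size (lead_coef f)).-1)%N.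
have m_gt0 h : h != 0 -> h \isn't a GRing.unit -> (0 < m h)%N.
  move=> h0; apply: contraNT; rewrite -leqNgt /m leqn0 addn_eq0 => /andP[s1 s2].
  have := h0; rewrite -lead_coef_eq0 -size_poly_gt0 => l0.
  have /eqP/size_poly1P[k k0 def_h] : size h = 1%N.
    by have := h0; rewrite -size_poly_gt0; case: (size h) s1 => [|[]].
  move: l0 s2; rewrite def_h lead_coefC => l0 s2.
  have /eqP/size_poly1P[k' k'0 ->] : size k = 1%N by case: (size k) s2 l0 => [|[]].
  by apply/biunitP; exists k'.
have mM h h' : h != 0 -> h' != 0 -> m (h * h') = (m h + m h')%N.
  move=> h0 h'0; rewrite /m lead_coefM size_mulFF // size_mulF ?lead_coef_eq0 //.
  have aux (a b c d : nat) : (0 < a -> 0 < b -> 0 < c -> 0 < d ->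
    (a + b).-1.-1 + (c + d).-1.-1 = a.-1 + c.-1 + (b.-1 + d.-1))%N by lia.
  by apply: aux; rewrite size_poly_gt0 ?lead_coef_eq0.
elim: (m f) {-2}f (leqnn (m f)) => [|n IH] {}f le_f f0 Pf.
  by apply: Pu; apply: contraTT le_f => /(m_gt0 _ f0); rewrite ltnNge.
have [/Pu //|nu_f] := boolP (f \is a GRing.unit).
have [irr_f|red_f] := EM (biirreducible f); first by apply: Pf => //; apply: bidvd_refl.
have [g [h [def_f nu_g nu_h]]] : exists g h,
    [/\ f = g * h, g \isn't a GRing.unit & h \isn't a GRing.unit].
  apply: contrapT => ex; apply: red_f; split=> // g h def_f.
  by apply: contrapT => /not_orP[/negP nu_g /negP nu_h]; apply: ex; exists g, h.
have [g0 h0] : g != 0 /\ h != 0.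
  by apply/andP; rewrite -negb_or -mulf_eq0 -def_f.
have := mM _ _ g0 h0; have := m_gt0 _ g0 nu_g; have := m_gt0 _ h0 nu_h.
rewrite -def_f => gt_h gt_g eq_f; rewrite def_f; apply: PM => //; apply: IH => //.
- by move: (m f) (m g) (m h) le_f gt_h gt_g eq_f => a b c; lia.
- by move=> p irr_p pg; apply: Pf; rewrite // def_f; apply: bidvd_mulr.
- by move: (m f) (m g) (m h) le_f gt_h gt_g eq_f => a b c; lia.
- by move=> p irr_p ph; apply: Pf; rewrite // def_f; apply: bidvd_mull.
Qed.

Lemma bimult_eq p f g m : biprime p -> f != 0 -> f = g * p ^+ m -> ~ bidvd p g ->
  bimult p f = m.
Proof.
move=> pr_p f0 def_f npg; have p0 := biprime_neq0 pr_p; have [_ ltp] := pr_p.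
(* As [p] has positive y-degree, [m] is at most the y-degree of [f] and so lies in the range of the
   maximum defining [bimult]. *)
have ltm : (m < size f)%N.
  have g0 : g != 0 by apply: contraNneq f0 => g0; rewrite def_f g0 mul0r.
  have aux (a b c : nat) : (1 < b -> 0 < a -> c.-1 = b.-1 * m -> 0 < c -> m < (a + c).-1)%N.
    by move=> *; nia.
  rewrite def_f size_mulFF ?expf_neq0 //.
  by apply: (aux _ (size p)); rewrite ?size_poly_gt0 ?expf_neq0 // size_exp.
apply/eqP; rewrite eqn_leq; apply/andP; split; last first.
  rewrite bimult.unlock; apply: (leq_bigmax_cond (Ordinal ltm)) => /=.
  by apply/asboolP; exists g.
rewrite bimult.unlock; apply/bigmax_leqP => i'; move: (nat_of_ord i') => i /asboolP[h def_f'].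
rewrite leqNgt; apply/negP => lt_mi.
apply: npg; exists (h * p ^+ (i - m.+1)).
have pm0 : p ^+ m != 0 by rewrite expf_neq0.
apply: (mulIf pm0); rewrite -def_f def_f' -!mulrA -!exprS -exprD.
by congr (_ * _ ^+ _); lia.
Qed.

Lemma bimultP p f : biprime p -> f != 0 ->
  exists2 g, f = g * p ^+ bimult p f & ~ bidvd p g.
Proof.
move=> pr_p f0; have [_ ltp] := pr_p; have p0 := biprime_neq0 pr_p.
suff [m [g [def_f npg]]] : exists m g, f = g * p ^+ m /\ ~ bidvd p g.
  by exists g; rewrite // (bimult_eq pr_p f0 def_f npg).
elim: (size f) {-2}f (leqnn (size f)) f0 => [|n IH] {}f le_f f0.
  by move: le_f; rewrite leqn0 size_poly_eq0 (negPf f0).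
have [[g def_f]|npf] := EM (bidvd p f); last first.
  by exists 0%N, f; rewrite expr0 mulr1.
have g0 : g != 0 by apply: contraNneq f0 => g0; rewrite def_f g0 mul0r.
have aux a b : (1 < b -> (a + b).-1 <= n.+1 -> a <= n)%N by lia.
have [|m [h [def_g nph]]] := IH g _ g0.
  by apply: (aux _ (size p)); rewrite // -size_mulFF // -def_f.
by exists m.+1, h; split; rewrite // exprSr mulrA -def_g.
Qed.

Lemma bimultM p f g : biprime p -> f != 0 -> g != 0 ->
  bimult p (f * g) = (bimult p f + bimult p g)%N.
Proof.
move=> pr_p f0 g0; have [f' def_f nf] := bimultP pr_p f0.
have [g' def_g ng] := bimultP pr_p g0.
apply: (@bimult_eq _ _ (f' * g')) => //; first by rewrite mulf_neq0.
  by rewrite {1}def_f {1}def_g exprD mulrACA.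
by case/(biprime_bidvdM pr_p).
Qed.

Lemma bimult_eq0 p f : biprime p -> f != 0 -> bimult p f = 0%N <-> ~ bidvd p f.
Proof.
move=> pr_p f0; split=> [m0|npf].
  by have [g] := bimultP pr_p f0; rewrite m0 expr0 mulr1 => <-.
by apply: (@bimult_eq _ _ f); rewrite ?expr0 ?mulr1.
Qed.

Lemma bimult_gt0 p f : biprime p -> f != 0 -> (0 < bimult p f)%N <-> bidvd p f.
Proof.
move=> pr_p f0; split=> [m0|pf].
  by apply: contrapT => /(bimult_eq0 pr_p f0) m; rewrite m in m0.
by rewrite lt0n; apply/eqP => /(bimult_eq0 pr_p f0).
Qed.

End Factorization.

(** * Finitely supported cocycles and linear dependence *)

Section FiniteSupport.
Implicit Types (w : int -> int) (a b : int) (B : nat).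

Lemma int_pred_invariant_eq0 w B :
    (forall a, w a = w (a - 1)) -> (forall a, (B < `|a|)%N -> w a = 0) ->
  forall a, w a = 0.
Proof.
move=> inv_w w0 a; have inv n : w a = w (a - n%:Z).
  elim: n => [|n ->]; first by rewrite subr0.
  by rewrite inv_w; congr (w _); lia.
by rewrite (inv (`|a| + B.+1)%N); apply: w0; lia.
Qed.

(** The window is [-B, B + 1]: at its upper end [w (b - 1)] may still be nonzero, and beyond it the
    difference vanishes. *)
Lemma window_telescope w B : (forall b, (B < `|b|)%N -> w b = 0) ->
  \sum_(t < (B + B).+2) (w (t%:Z - B%:Z - 1) - w (t%:Z - B%:Z)) = 0.
Proof.
move=> w0; have tele n : \sum_(t < n) (w (t%:Z - B%:Z - 1) - w (t%:Z - B%:Z))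
    = w (- B%:Z - 1) - w (n%:Z - B%:Z - 1).
  elim: n => [|n IH]; first by rewrite big_ord0 sub0r subrr.
  rewrite big_ord_recr /= IH (_ : n.+1%:Z - B%:Z - 1 = n%:Z - B%:Z); last lia.
  by rewrite addrA subrK.
by rewrite tele !w0 ?subrr //; lia.
Qed.

(* E1 and E2 are the divisors of the two shift quotients of a term, W that of
   u / v and rho that of r / s, all restricted to one free Z^2-orbit of primes.
   Row sums of E2 are independent of the row, hence zero, and so is rho. *)
Lemma divisor_cocycle (E1 E2 W rho : int -> int -> int) B :
    (forall a b, (B < `|a|)%N || (B < `|b|)%N ->
      [/\ E1 a b = 0, E2 a b = 0 & W a b = 0]) ->
    (forall a b, E1 a (b - 1) + E2 a b = E1 a b + E2 (a - 1) b) ->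
    (forall a b, E2 a b = W a (b - 1) - W a b + rho a b) ->
    (forall a, (forall b, 0 <= rho a b) \/ (forall b, rho a b <= 0)) ->
  (forall a b, rho a b = 0) /\ (forall a b, E1 a b = W (a - 1) b - W a b).
Proof.
move=> supp compat def_E2 sgn.
have out a b : (B < `|b|)%N -> [/\ E1 a b = 0, E2 a b = 0 & W a b = 0].
  by move=> lb; apply: supp; rewrite lb orbT.
pose row a := \sum_(t < (B + B).+2) E2 a (t%:Z - B%:Z).
(* By compatibility, consecutive rows of [E2] differ by differences of [E1] in [b], which telescope
   to zero over the window. *)
have row0 a : row a = 0.
  move: a; apply: (@int_pred_invariant_eq0 _ B) => [a|a la]; last first.
    by apply: big1 => t _; have [] // := supp a (t%:Z - B%:Z); rewrite la.
  apply/eqP; rewrite -subr_eq0 /row -sumrB -oppr_eq0 -sumrN; apply/eqP.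
  rewrite -[RHS](@window_telescope (E1 a) B); last by move=> b /(out a)[].
  by apply: eq_bigr => t _; have := compat a (t%:Z - B%:Z); lia.
(* The contribution of [W] to [E2] telescopes, so each row of [rho] sums to zero; entries of
   constant sign then vanish. *)
have rho0 a b : rho a b = 0.
  have sum0 : \sum_(t < (B + B).+2) rho a (t%:Z - B%:Z) = 0.
    rewrite -[RHS](row0 a) /row.
    under [in RHS]eq_bigr => t _ do rewrite def_E2.
    rewrite big_split /=.
    by rewrite (@window_telescope (W a) B) ?add0r // => b' /(out a)[].
  have all0 t : rho a ((t : 'I_(B + B).+2)%:Z - B%:Z) = 0.
    have [pos|neg] := sgn a.
      by apply: (psumr_eq0P (fun t _ => pos _) sum0).
    apply/eqP; rewrite -oppr_eq0; apply/eqP.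
    have sumN0 : \sum_(t < (B + B).+2) - rho a (t%:Z - B%:Z) = 0.
      by rewrite sumrN sum0 oppr0.
    by apply: (psumr_eq0P _ sumN0) => // t' _; rewrite oppr_ge0.
  have [/andP[leb geb]|nb] := boolP ((- B%:Z <= b) && (b <= B.+1%:Z)); last first.
    have [|_ e2 w2] := out a b; first by move: nb; lia.
    have [|_ _ w1] := out a (b - 1); first by move: nb; lia.
    by have := def_E2 a b; rewrite e2 w2 w1; lia.
  have lt : (`|(b + B%:Z)%R| < (B + B).+2)%N by move: leb geb; lia.
  have := all0 (Ordinal lt); congr (rho a _ = _); rewrite /=.
  by move: leb geb; lia.
split=> // a b.
(* With [rho] zero, compatibility says that the difference of both sides is unchanged by
   [b -> b - 1]; finite support makes it zero. *)
apply/eqP; rewrite -subr_eq0; apply/eqP.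
move: b; apply: (@int_pred_invariant_eq0 _ B) => b; last first.
  by move=> lb; have [-> _ ->] := out a b lb; have [_ _ ->] := out (a - 1) b lb.
have := compat a b; rewrite !def_E2 !rho0; lia.
Qed.

End FiniteSupport.

(** Elimination without fractions: cross-multiplying with a pivot [P i0] cancels the coefficient of
    degree [d], at the price of one element of [S]. *)
Lemma poly_lin_dep (R : idomainType) (A : finType) d (S : {set A})
    (P : A -> {poly R}) :
    (forall i, i \in S -> (size (P i) <= d)%N) -> (d < #|S|)%N ->
  exists2 c : A -> R, exists2 i, i \in S & c i != 0
    & \sum_(i in S) c i *: P i = 0.
Proof.
elim: d S P => [|d IH] S P szP ltS.
  have /card_gt0P[i Si] := ltS; exists (fun=> 1); first by exists i; rewrite ?oner_neq0.
  apply: big1 => j Sj; apply/eqP; rewrite scale1r -size_poly_eq0 -leqn0; exact: szP.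
have [ex|nex] := EM (exists2 i, i \in S & (P i)`_d != 0); last first.
  apply: IH; last exact: ltnW.
  move=> i Si; apply/leq_sizeP => j; rewrite leq_eqVlt => /predU1P[<-|ltj].
    by apply/eqP/negP => /negP n0; apply: nex; exists i.
  by apply: nth_default; apply: leq_trans (szP _ Si) ltj.
case: ex => i0 Si0 p0; pose Q i := (P i0)`_d *: P i - (P i)`_d *: P i0.
have [i||c [i Si ci] sum0] := IH (S :\ i0) Q.
- move=> /setD1P[_ Si]; apply/leq_sizeP => j.
  rewrite leq_eqVlt coefB !coefZ => /predU1P[<-|ltj]; first by rewrite mulrC subrr.
  rewrite [(P i)`_j]nth_default ?[(P i0)`_j]nth_default ?mulr0 ?subrr //.
    exact: leq_trans (szP _ Si0) ltj.
  exact: leq_trans (szP _ Si) ltj.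
- by move: ltS; rewrite (cardsD1 i0) Si0.
pose c' i := if i == i0 then - \sum_(j in S :\ i0) c j * (P j)`_d
             else c i * (P i0)`_d.
exists c'.
  have /setD1P[ni Si'] := Si; exists i => //.
  by rewrite /c' (negPf ni) mulf_neq0.
rewrite (big_setD1 i0) //= {1}/c' eqxx scaleNr scaler_suml addrC -sumrB -[RHS]sum0.
apply: eq_bigr => j /setD1P[nj _]; rewrite /c' (negPf nj) /Q.
by rewrite scalerBr !scalerA.
Qed.

(** * Bivariate polynomials on the grid of the points (q^n, q^k) *)

Section Biscale.
Variable F : fieldType.
Implicit Types (a b c d : F) (f g p : {poly {poly F}}).

Lemma bievalD f g a b : bieval (f + g) a b = bieval f a b + bieval g a b.
Proof. by rewrite /bieval !hornerD. Qed.

Lemma bievalN f a b : bieval (- f) a b = - bieval f a b.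
Proof. by rewrite /bieval !hornerN. Qed.

Lemma bievalM f g a b : bieval (f * g) a b = bieval f a b * bieval g a b.
Proof. by rewrite /bieval !hornerM. Qed.

Lemma bieval1 a b : bieval (1 : {poly {poly F}}) a b = 1.
Proof. by rewrite /bieval !hornerC. Qed.

Lemma bieval0 a b : bieval (0 : {poly {poly F}}) a b = 0.
Proof. by rewrite /bieval !horner0. Qed.

Lemma bievalC (c : {poly F}) a b : bieval c%:P a b = c.[a].
Proof. by rewrite /bieval hornerC. Qed.

Lemma bievalX a b : bieval 'X a b = b.
Proof. by rewrite /bieval hornerX hornerC. Qed.

Lemma biscale_is_zmod_morphism a b : zmod_morphism (biscale a b : {poly {poly F}} -> _).
Proof. by move=> f g; rewrite /biscale !rmorphB. Qed.

Lemma biscale_is_monoid_morphism a b :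
  monoid_morphism (biscale a b : {poly {poly F}} -> _).
Proof. by split=> [|f g]; rewrite /biscale ?rmorph1 ?rmorphM. Qed.

HB.instance Definition _ a b := GRing.isZmodMorphism.Build
  {poly {poly F}} {poly {poly F}} (biscale a b) (biscale_is_zmod_morphism a b).
HB.instance Definition _ a b := GRing.isMonoidMorphism.Build
  {poly {poly F}} {poly {poly F}} (biscale a b) (biscale_is_monoid_morphism a b).

Lemma bieval_biscale a b c d f :
  bieval (biscale a b f) c d = bieval f (a * c) (b * d).
Proof.
rewrite /bieval; elim/poly_ind: f => [|f p IH]; first by rewrite rmorph0 !horner0.
rewrite rmorphD rmorphM /= !hornerD !hornerM IH {IH}; congr (_ * _ + _).
  rewrite /biscale map_polyX comp_polyX !hornerE.
  by rewrite mulrC.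
by rewrite /biscale map_polyC comp_polyC /= !hornerC horner_comp !hornerE.
Qed.

Lemma bieval_swapXY f a b : bieval (swapXY f) a b = bieval f b a.
Proof.
rewrite /bieval horner_swapXY.
have -> : f.[a%:P].[b] = horner_eval b f.[a%:P] by [].
by rewrite -horner_map /= /horner_eval hornerC.
Qed.

End Biscale.

Section Grid.
Variables (F : fieldType) (q : F).
Hypothesis q_neq0 : q != 0.
Hypothesis q_nroot : forall m : nat, (0 < m)%N -> q ^+ m != 1.
Implicit Types (f g h p r s u v A B D : {poly {poly F}}) (i j n k : nat) (a b : int).

Local Notation ev f n k := (bieval f (q ^+ n) (q ^+ k)).

Lemma expq_inj : injective (fun n => q ^+ n).
Proof.
move=> m n /= eqmn; wlog lemn : m n eqmn / (m <= n)%N.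
  by move=> hw; case/orP: (leq_total m n) => h; [|apply/esym]; apply: hw.
apply/eqP; rewrite eqn_leq lemn /= leqNgt; apply/negP => ltmn.
have /negP[] : q ^+ (n - m) != 1 by apply: q_nroot; rewrite subn_gt0.
have qm : q ^+ m != 0 by rewrite expf_neq0.
by rewrite -(inj_eq (mulfI qm)) mulr1 -exprD subnKC // eqmn.
Qed.

Lemma expqz_eq1 a : q ^ a = 1 -> a = 0.
Proof.
case: a => n; rewrite ?NegzE /= => h.
  by congr Posz; apply: expq_inj; rewrite /= expr0.
have := q_nroot (ltn0Sn n); rewrite -invr_eq1 => /eqP[].
exact: h.
Qed.

Lemma horner_expq_eq0 (R : idomainType) (e : nat -> R) (c : {poly R}) :
  injective e -> (forall n, c.[e n] = 0) -> c = 0.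
Proof.
move=> inj_e c0; apply/eqP/negP => /negP cn0.
have := @max_poly_roots _ c (mkseq e (size c)) cn0.
rewrite size_mkseq ltnn => /(_ _ _)/negP; apply => //.
  by apply/allP => x /mapP[n _ ->]; rewrite rootE c0.
by rewrite mkseq_uniq.
Qed.

(** Density is used twice: in [y], at the constants [q ^+ k] of F[x], then in [x] for each of these
    values. *)
Lemma ev_eq0 f : (forall n k, ev f n k = 0) -> f = 0.
Proof.
move=> f0; apply: (@horner_expq_eq0 _ (fun k => (q ^+ k)%:P)).
  by move=> k k' /polyC_inj/expq_inj.
move=> k; apply: (@horner_expq_eq0 _ (fun n => q ^+ n)); first exact: expq_inj.
by move=> n; apply: f0.
Qed.

Lemma ev_inj f g : (forall n k, ev f n k = ev g n k) -> f = g.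
Proof.
move=> fg; apply/eqP; rewrite -subr_eq0; apply/eqP/ev_eq0 => n k.
by rewrite bievalD bievalN fg subrr.
Qed.

Lemma biscaleM (x y z t : F) f :
  biscale x y (biscale z t f) = biscale (x * z) (y * t) f.
Proof.
by apply: ev_inj => n k; rewrite !bieval_biscale !mulrA ![z * _]mulrC ![t * _]mulrC.
Qed.

Lemma biscale11 f : biscale 1 1 f = f.
Proof. by apply: ev_inj => n k; rewrite bieval_biscale !mul1r. Qed.

Lemma swapXY_biscale (x y : F) f :
  swapXY (biscale x y f) = biscale y x (swapXY f).
Proof.
by apply: ev_inj => n k; rewrite !(bieval_swapXY, bieval_biscale).
Qed.

Definition qshift a b f := biscale (q ^ a) (q ^ b) f.

HB.instance Definition _ a b := GRing.isZmodMorphism.Build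
  {poly {poly F}} {poly {poly F}} (qshift a b) (biscale_is_zmod_morphism _ _).
HB.instance Definition _ a b := GRing.isMonoidMorphism.Build
  {poly {poly F}} {poly {poly F}} (qshift a b) (biscale_is_monoid_morphism _ _).

Lemma qshiftD a b a' b' f :
  qshift a b (qshift a' b' f) = qshift (a + a') (b + b') f.
Proof. by rewrite /qshift biscaleM !expfzDr. Qed.

Lemma qshift0 f : qshift 0 0 f = f.
Proof. exact: biscale11. Qed.

Lemma qshiftK a b : cancel (qshift a b) (qshift (- a) (- b)).
Proof. by move=> f; rewrite qshiftD !addNr qshift0. Qed.

Lemma qshiftNK a b : cancel (qshift (- a) (- b)) (qshift a b).
Proof. by move=> f; rewrite qshiftD !addrN qshift0. Qed.

Lemma qshift_eq0 a b f : (qshift a b f == 0) = (f == 0).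
Proof. by rewrite raddf_eq0 //; apply: can_inj (qshiftK a b). Qed.

Lemma ev_qshift i j f n k : ev (qshift i j f) n k = ev f (n + i) (k + j).
Proof. by rewrite bieval_biscale -!exprnP -!exprD [(i + n)%N]addnC [(j + k)%N]addnC. Qed.

Lemma size_qshift a b f : size (qshift a b f) = size f.
Proof.
have qn x : q ^ x != 0 by rewrite expfz_neq0.
rewrite /qshift /biscale size_comp_poly2; last first.
  by rewrite size_scale ?size_polyX // polyC_eq0.
apply: size_map_inj_poly; last by rewrite comp_poly0.
move=> c d /eqP; rewrite -subr_eq0 -comp_polyB comp_poly_eq0 ?size_scale ?size_polyX //.
by rewrite subr_eq0 => /eqP.
Qed.

Lemma qshift_polyC a b (c : {poly F}) :
  qshift a b c%:P = (c \Po (q ^ a *: 'X))%:P.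
Proof. by rewrite /qshift /biscale map_polyC comp_polyC. Qed.

Lemma bidvd_qshift a b f g : bidvd f g -> bidvd (qshift a b f) (qshift a b g).
Proof. by move=> [h ->]; exists (qshift a b h); rewrite rmorphM. Qed.

(** A rational function without poles on the grid. The fraction may depend on the point, since one
    denominator need not be nonzero everywhere; its cross-multiplied equation still holds on the
    whole grid. *)
Definition gridreg (phi : nat -> nat -> F) := forall n k, exists f g : {poly {poly F}},
  ev g n k != 0 /\ forall n' k', phi n' k' * ev g n' k' = ev f n' k'.

Lemma gridreg_ext phi psi : phi =2 psi -> gridreg phi -> gridreg psi.
Proof.
move=> eq_phi reg n k; have [f [g [gn0 def]]] := reg n k.
by exists f, g; split=> // n' k'; rewrite -eq_phi.
Qed.

Lemma gridreg_ev f : gridreg (fun n k => ev f n k).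
Proof.
move=> n k; exists f, 1; rewrite bieval1 oner_neq0; split=> // n' k'.
by rewrite bieval1 mulr1.
Qed.

Lemma gridreg_horner (c : {poly F}) : gridreg (fun n k => c.[q ^+ n]).
Proof. by apply: gridreg_ext (gridreg_ev c%:P) => n k; rewrite bievalC. Qed.

Lemma gridregD phi psi : gridreg phi -> gridreg psi ->
  gridreg (fun n k => phi n k + psi n k).
Proof.
move=> r1 r2 n k; have [f [g [g0 def]]] := r1 n k; have [f' [g' [g'0 def']]] := r2 n k.
exists (f * g' + f' * g), (g * g'); split; first by rewrite bievalM mulf_neq0.
by move=> n' k'; rewrite !(bievalM, bievalD) -def -def'; ring.
Qed.

Lemma gridregM phi psi : gridreg phi -> gridreg psi ->
  gridreg (fun n k => phi n k * psi n k).
Proof.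
move=> r1 r2 n k; have [f [g [g0 def]]] := r1 n k; have [f' [g' [g'0 def']]] := r2 n k.
exists (f * f'), (g * g'); split; first by rewrite bievalM mulf_neq0.
by move=> n' k'; rewrite !bievalM -def -def'; ring.
Qed.

Lemma gridregN phi : gridreg phi -> gridreg (fun n k => - phi n k).
Proof.
move=> reg; apply: gridreg_ext (gridregM (gridreg_ev (- 1)) reg) => n k.
by rewrite bievalN bieval1 mulN1r.
Qed.

Lemma gridreg_sum (I : Type) (s : seq I) (phi : I -> nat -> nat -> F) :
  (forall x, gridreg (phi x)) -> gridreg (fun n k => \sum_(i <- s) phi i n k).
Proof.
move=> reg; elim: s => [|i s IH].
  by apply: gridreg_ext (gridreg_ev 0) => n k; rewrite big_nil bieval0.
by apply: gridreg_ext (gridregD (reg i) IH) => n k; rewrite big_cons.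
Qed.

Lemma gridreg_shift i j phi : gridreg phi ->
  gridreg (fun n k => phi (n + i)%N (k + j)%N).
Proof.
move=> reg n k; have [f [g [g0 def]]] := reg (n + i)%N (k + j)%N.
exists (qshift i j f), (qshift i j g); rewrite ev_qshift; split=> // n' k'.
by rewrite !ev_qshift.
Qed.

(** The cancellation rule for factors that may vanish at grid points: the numerator of any fraction
    representing [phi] is killed by [h], hence zero by density, and some denominator is nonzero at
    the given point. *)
Lemma gridreg_eq0 phi h : gridreg phi -> h != 0 ->
  (forall n k, phi n k * ev h n k = 0) -> forall n k, phi n k = 0.
Proof.
move=> reg h0 phih n k; have [f [g [g0 def]]] := reg n k.
have f0 : f = 0.
  apply: (mulIf h0); rewrite mul0r; apply: ev_eq0 => n' k'.
  by rewrite bievalM -def mulrAC phih mul0r.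
by apply: (mulIf g0); rewrite def f0 bieval0 mul0r.
Qed.

Lemma gridreg_frac phi : gridreg phi ->
  exists f g, g != 0 /\ forall n k, phi n k * ev g n k = ev f n k.
Proof.
move=> reg; have [f [g [g0 def]]] := reg 0%N 0%N; exists f, g; split=> //.
by apply: contraNneq g0 => ->; rewrite bieval0.
Qed.

Lemma tofrac_div_eq f g f' g' : g != 0 -> g' != 0 ->
  f%:FF / g%:FF = f'%:FF / g'%:FF -> f * g' = f' * g.
Proof.
move=> g0 g'0 /eqP; rewrite eqr_div ?tofrac_eq0 // -!tofracM tofrac_eq.
by move=> /eqP.
Qed.

Lemma fracP (R : birat F) : exists f g, g != 0 /\ R = f%:FF / g%:FF.
Proof.
elim/quotW: R => x; exists (\n_x), (\d_x); split; first exact: denom_ratioP.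
have d0 : (\d_x)%:FF != 0 by rewrite tofrac_eq0 denom_ratioP.
apply: (mulIf d0); rewrite mulfVK //; rewrite !piE; apply/eqmodP => /=.
rewrite /= FracField.equivfE !numden_Ratio ?mulf_neq0 ?oner_neq0 ?denom_ratioP //.
by rewrite !mulr1 mulrC.
Qed.

Lemma value_at_frac (R : birat F) n k c f g : value_at R (q ^+ n) (q ^+ k) c ->
  g != 0 -> R = f%:FF / g%:FF -> c * ev g n k = ev f n k.
Proof.
move=> [f' [g' [-> g'0 ->]]] g0 eqR; apply: (mulIf g'0).
have g'n0 : g' != 0 by apply: contraNneq g'0 => ->; rewrite bieval0.
by rewrite mulrAC mulfVK // -!bievalM (tofrac_div_eq g'n0 g0 eqR).
Qed.

Lemma gridreg_value (R : birat F) phi :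
  (forall n k, value_at R (q ^+ n) (q ^+ k) (phi n k)) -> gridreg phi.
Proof.
move=> val n k; have [f [g [defR g0 _]]] := val n k.
exists f, g; split=> // n' k'; apply: value_at_frac (val n' k') _ defR.
by apply: contraNneq g0 => ->; rewrite bieval0.
Qed.

(** * Common multiples of the shifts of q-proper polynomials *)

Lemma coef_biscale (x y : F) f m :
  (biscale x y f)`_m = y ^+ m *: (f`_m \Po (x *: 'X)).
Proof.
elim/poly_ind: f m => [|f c IH] m.
  by rewrite rmorph0 !coef0 comp_poly0 scaler0.
rewrite rmorphD rmorphM /= !coefD.
have -> : biscale x y 'X = y%:P *: 'X by rewrite /biscale map_polyX comp_polyX.
have -> : biscale x y c%:P = (c \Po (x *: 'X))%:P.
  by rewrite /biscale map_polyC comp_polyC.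
rewrite -scalerAr coefZ !coefMX !coefC; case: m => [|m] /=.
  by rewrite mulr0 !add0r expr0 scale1r.
by rewrite IH !addr0 mul_polyC scalerA exprS.
Qed.

Lemma dvdp_qshift a b f g : f %| g -> qshift a b f %| qshift a b g.
Proof.
move=> /Pdiv.Idomain.dvdpP[[c h] /= c0 def]; apply/Pdiv.Idomain.dvdpP.
have /(congr1 (qshift a b)) := def; rewrite -mul_polyC !rmorphM /= qshift_polyC => e.
exists (c \Po (q ^ a *: 'X), qshift a b h) => /=; last by rewrite -mul_polyC.
by rewrite -polyC_eq0 -(qshift_polyC a b) qshift_eq0 polyC_eq0.
Qed.

Lemma eqp_qshift a b f g : f %= g -> qshift a b f %= qshift a b g.
Proof. by move=> /andP[fg gf]; rewrite /eqp !dvdp_qshift. Qed.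

Lemma eqp_prod (I : Type) (s : seq I) (G H : I -> {poly {poly F}}) :
  (forall x, G x %= H x) -> \prod_(x <- s) G x %= \prod_(x <- s) H x.
Proof.
move=> GH; elim: s => [|x s IH]; first by rewrite !big_nil eqpxx.
rewrite !big_cons; have /andP[d1 d2] := GH x; have /andP[d3 d4] := IH.
by apply/andP; split; apply: dvdp_mul.
Qed.

Lemma size_prod_bound n M (G : nat -> {poly {poly F}}) :
    (forall i, (size (G i) <= M.+1)%N) ->
  (size (\prod_(i < n) G i)%R <= (n * M).+1)%N.
Proof.
move=> szG; elim: n => [|n IH]; first by rewrite big_ord0 size_poly1.
rewrite big_ord_recr /=; apply: leq_trans (size_polyMleq _ _) _.
have aux (x y : nat) : (x <= (n * M).+1 -> y <= M.+1 -> (x + y).-1 <= (n.+1 * M).+1)%N.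
  by rewrite mulSn; lia.
exact: aux.
Qed.

Lemma dvdp_prod_window t m n (G : nat -> {poly {poly F}}) : (t + m <= n)%N ->
  \prod_(l < m) G (t + l)%N %| \prod_(l < n) G l.
Proof.
move=> le_n; have -> : n = (t + (m + (n - (t + m))))%N by lia.
by rewrite !big_split_ord /=; apply: dvdp_mull; apply: dvdp_mulr.
Qed.

(* %| is divisibility over F(x). *)
Definition lin_bounded f := exists C : nat, forall I J : nat, exists D : {poly {poly F}},
  [/\ D != 0, (size D <= (C * (I + J).+1).+1)%N
    & forall i j, (i <= I)%N -> (j <= J)%N -> \prod_(l < j.+1) qshift i l f %| D].

Lemma lin_bounded_unit f : f \is a GRing.unit -> lin_bounded f.
Proof.
case/biunitP=> c c0 ->; exists 0%N => I J; exists 1.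
rewrite oner_neq0 size_poly1; split=> // i j _ _.
have : \prod_(l < j.+1) qshift i l c%:P%:P %= \prod_(l < j.+1) 1.
  apply: eqp_prod => l; rewrite qshift_polyC comp_polyC.
  by rewrite /eqp dvd1p andbT dvdp1 size_polyC polyC_eq0 c0.
by move=> /eqp_dvdl ->; rewrite big1.
Qed.

Lemma lin_boundedM f g : lin_bounded f -> lin_bounded g -> lin_bounded (f * g).
Proof.
move=> [C bf] [C' bg]; exists (C + C')%N => I J.
have [D [D0 szD dvdD]] := bf I J; have [D' [D'0 szD' dvdD']] := bg I J.
exists (D * D'); split=> [||i j lei lej]; first by rewrite mulf_neq0.
  rewrite size_mulFF //; move: (size D) (size D') szD szD' => x y; rewrite mulnDl; lia.
under eq_bigr => l _ do rewrite rmorphM /=.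
by rewrite big_split; apply: dvdp_mul; [apply: dvdD|apply: dvdD'].
Qed.

Lemma lin_bounded_Xn p m : p %= 'X^m -> lin_bounded p.
Proof.
move=> eq_p; exists m => I J; exists ('X^(m * J.+1)).
rewrite monic_neq0 ?monicXn // size_polyXn; split=> // [|i j _ lej].
  by rewrite ltnS leq_mul2l; apply/orP; right; lia.
have X_shift a b : qshift a b 'X %= 'X.
  rewrite /qshift /biscale map_polyX comp_polyX; apply: eqp_scale.
  by rewrite polyC_eq0 expfz_neq0.
have : \prod_(l < j.+1) qshift i l p %= \prod_(l < j.+1) 'X^m.
  apply: eqp_prod => l; apply: eqp_trans (eqp_qshift _ _ eq_p) _.
  by rewrite rmorphXn /=; apply: eqp_exp.
move=> /eqp_dvdl ->; rewrite prodr_const card_ord -exprM dvdp_exp2l //.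
by rewrite leq_mul2l; apply/orP; right.
Qed.

(** A shift preserves the y-degree, so divisibility already means association over F(x). *)
Lemma qshift_self_eqp p a b : p != 0 -> bidvd p (qshift a b p) -> p %= qshift a b p.
Proof.
by move=> p0 /bidvd_dvdp pp; rewrite -dvdp_size_eqp // size_qshift.
Qed.

(** A nonzero coefficient of degree [l], compared with the leading one of degree [m], gives
    [q ^ (b * (m - l)) = 1], so [l = m]: over F(x), [p] is associated to a power of [y]. *)
Lemma lin_bounded_y_invariant p b : p != 0 -> b != 0 ->
  p %= qshift 0 b p -> lin_bounded p.
Proof.
move=> p0 b0 /eqpP[[c d] /= /andP[c0 d0] eq_p]; pose m := (size p).-1.
have coefE l : c * p`_l = d * ((q ^ b) ^+ l)%:P * p`_l.
  have := congr1 (fun f : {poly {poly F}} => f`_l) eq_p.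
  rewrite !coefZ /qshift coef_biscale scale1r comp_polyXr => ->.
  by rewrite -mulrA mul_polyC.
have lead0 : p`_m != 0 by rewrite -lead_coefE lead_coef_eq0.
have def_c : c = d * ((q ^ b) ^+ m)%:P by apply: (mulIf lead0); apply: coefE.
have coef0 l : l != m -> p`_l = 0.
  move=> neq_l; apply/eqP/negP => /negP pl0.
  have /(mulIf pl0) := coefE l; rewrite def_c => /(mulfI d0)/polyC_inj.
  rewrite !exprnP !exprz_exp => e.
  have : q ^ (b * (m%:Z - l%:Z)) = 1.
    by rewrite mulrBr expfzDr // -invr_expz -e divff // expfz_neq0.
  by move/expqz_eq1 => /eqP; rewrite mulf_eq0 (negPf b0) /=; move: neq_l; lia.
apply: (@lin_bounded_Xn _ m).
have -> : p = p`_m *: 'X^m.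
  apply/polyP => l; rewrite coefZ coefXn; case: eqVneq => [->|/coef0 ->].
    by rewrite mulr1.
  by rewrite mulr0.
exact: eqp_scale.
Qed.

(** Up to association, shifting [x] by [A] amounts to shifting [y] by [- b]. Only the residue of an
    x-shift modulo [A] matters, and all products are windows in [A] sequences of y-shifts. *)
Lemma lin_bounded_invariant p (A : nat) b : p != 0 -> (0 < A)%N ->
  p %= qshift A b p -> lin_bounded p.
Proof.
move=> p0 A0 eq_p.
have eq_pe (e : nat) : p %= qshift (A * e)%N (b * e%:Z) p.
  elim: e => [|e IH]; first by rewrite muln0 mulr0 qshift0 eqpxx.
  apply: eqp_trans IH _; have := eqp_qshift (A * e)%N (b * e%:Z) eq_p.
  rewrite qshiftD; congr (_ %= qshift _ _ _); lia.
(* For [i = A * e + i %% A] the y-shift [l] turns into [l - b * e], which lies between [- |b| * I]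
   and [J + |b| * I]. [N] counts these values, and [C] comes from [N <= (1 + 2 * |b|) * (I + J + 1)]
   in each of the [A] sequences. *)
pose C := (A * (1 + 2 * `|b|) * size p)%N; exists C => I J.
pose N := (J.+1 + 2 * `|b| * I)%N.
pose G (i t : nat) := qshift i (t%:Z - (`|b| * I)%N%:Z) p.
exists (\prod_(i < A) \prod_(t < N) G i t); split=> [||i j lei lej].
- by apply/prodf_neq0 => i _; apply/prodf_neq0 => t _; rewrite qshift_eq0.
- have szG i : (size (\prod_(t < N) G i t)%R <= (N * size p).+1)%N.
    by apply: size_prod_bound => t; rewrite size_qshift ltnW.
  apply: leq_trans (size_prod_bound A szG) _.
  rewrite ltnS mulnA /C /N; move: (size p) `|b|%N => x y.
  have -> : (A * (1 + 2 * y) * x * (I + J).+1 = A * ((1 + 2 * y) * (I + J).+1) * x)%N.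
    by ring.
  rewrite leq_mul2r leq_mul2l; apply/orP; right; apply/orP; right; nia.
have lt_i : (i %% A < A)%N by rewrite ltn_mod.
rewrite (bigD1 (Ordinal lt_i)) //=; apply: dvdp_mulr.
pose e := (i %/ A)%N; have le_e : (e <= I)%N by apply: leq_trans (leq_div _ _) lei.
pose t := absz ((`|b| * I)%N%:Z - b * e%:Z)%R.
have le_be : (absz (b * e%:Z)%R <= `|b| * I)%N.
  by rewrite abszM leq_mul2l; apply/orP; right.
have def_t : t%:Z = (`|b| * I)%N%:Z - b * e%:Z by rewrite /t; move: le_be; lia.
have le_t : (t + j.+1 <= N)%N.
  by rewrite /N; move: le_be def_t lej; rewrite -mulnA; lia.
have := dvdp_prod_window (G (i %% A)%N) le_t; apply: dvdp_trans.
suff /eqp_dvdl -> : \prod_(l < j.+1) qshift i l p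
  %= \prod_(l < j.+1) G (i %% A)%N (t + l)%N by [].
apply: eqp_prod => l; rewrite eqp_sym.
have := eqp_qshift (i %% A)%N ((t + l)%N%:Z - (`|b| * I)%N%:Z) (eq_pe e).
rewrite qshiftD /G; congr (_ %= qshift _ _ _).
  by rewrite -PoszD addnC mulnC -divn_eq.
by rewrite PoszD def_t; lia.
Qed.

(** A stabilising shift with [a = 0] makes the irreducible factor a monomial in [y]; one with
    negative [a] is replaced by its inverse. *)
Lemma qproper_lin_bounded f : qproper_poly q f -> lin_bounded f.
Proof.
move=> [f0 proper]; apply: bifactor_ind f0 _; [exact: lin_bounded_unit| |].
  by move=> g h _ _; apply: lin_boundedM.
move=> p irr_p /(proper p irr_p)[a [b [ab0 pp]]].
have p0 : p != 0 by case: irr_p.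
have eq_p := qshift_self_eqp p0 pp.
have [a0|an0] := eqVneq a 0.
  apply: (@lin_bounded_y_invariant _ b) => //; last by rewrite -a0.
  by apply: contraNneq ab0 => b0; rewrite a0 b0.
case: a an0 eq_p {ab0 pp} => [A|A] an0 eq_p.
  by apply: lin_bounded_invariant eq_p => //; move: an0; lia.
apply: (@lin_bounded_invariant _ A.+1 (- b)) => //.
have := eqp_qshift A.+1 (- b) eq_p; rewrite qshiftD addNr NegzE addrN qshift0.
by rewrite eqp_sym.
Qed.

(** * Recurrences with coefficients free of k, and telescoping *)

Lemma ratioN_iter (T : nat -> nat -> F) A B :
    (forall n k, T n.+1 k * ev B n k = ev A n k * T n k) ->
  forall i n k, T (n + i)%N k * ev (\prod_(l < i) qshift l 0 B) n k
    = ev (\prod_(l < i) qshift l 0 A) n k * T n k.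
Proof.
move=> rec; elim=> [|i IH] n k; first by rewrite !big_ord0 !bieval1 addn0 mulrC.
rewrite !big_ord_recr /= !bievalM !ev_qshift addn0 addnS mulrCA rec.
have := IH n k; set PB := bieval (\prod_(_ < _) qshift _ _ B) _ _ => e.
transitivity (ev A (n + i) k * (T (n + i)%N k * PB)); first by ring.
by rewrite e; ring.
Qed.

Section RegularTerm.
Variable T : nat -> nat -> F.
Hypothesis T_neq0 : forall n k, T n k != 0.
Hypothesis regN : gridreg (fun n k => T n.+1 k / T n k).
Hypothesis regK : gridreg (fun n k => T n k.+1 / T n k).

Lemma gridreg_ratio i j : gridreg (fun n k => T (n + i)%N (k + j)%N / T n k).
Proof.
have regK' : gridreg (fun n k => T n (k + j)%N / T n k).
  elim: j => [|j IH].
    apply: gridreg_ext (gridreg_ev 1) => n k.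
    by rewrite addn0 bieval1 divff.
  apply: gridreg_ext (gridregM IH (gridreg_shift 0 j regK)) => n k.
  by rewrite addn0 addnS mulrC mulrA mulfVK.
elim: i => [|i IH].
  by apply: gridreg_ext regK' => n k; rewrite addn0.
apply: gridreg_ext (gridregM IH (gridreg_shift i j regN)) => n k.
by rewrite addnS mulrC mulrA mulfVK.
Qed.

(** The shifts of [u] and [v] telescope and only the two ends remain. The intermediate factor
    [qshift 0 j (u * v)] may vanish on the grid; it is cancelled through the regularity of the shift
    quotients. *)
Lemma ratioK_iter r s u v : u != 0 -> v != 0 ->
    (forall n k, T n k.+1 * ev (s * (qshift 0 1 v * u)) n k
                 = ev (r * (qshift 0 1 u * v)) n k * T n k) ->
  forall j n k, T n (k + j)%N * ev ((\prod_(l < j) qshift 0 l s) * (qshift 0 j v * u)) n k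
    = ev ((\prod_(l < j) qshift 0 l r) * (qshift 0 j u * v)) n k * T n k.
Proof.
move=> u0 v0 rec; elim=> [|j IH] n k.
  by rewrite !big_ord0 addn0 !qshift0 !bievalM; ring.
set Dn := (X in _ * ev X _ _ = _); set Nm := (X in _ = ev X _ _ * _).
have reg : gridreg (fun n k => T n (k + j.+1)%N / T n k * ev Dn n k - ev Nm n k).
  apply: gridregD (gridregN (gridreg_ev Nm)); apply: gridregM (gridreg_ev Dn).
  by apply: gridreg_ext (gridreg_ratio 0 j.+1) => n' k'; rewrite addn0.
have uv0 : qshift 0 j (u * v) != 0 by rewrite qshift_eq0 mulf_neq0.
suff /(gridreg_eq0 reg uv0)/(_ n k) : forall n k,
    (T n (k + j.+1)%N / T n k * ev Dn n k - ev Nm n k) * ev (qshift 0 j (u * v)) n k = 0.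
  move=> /eqP; rewrite subr_eq0 mulrAC => /eqP <-.
  by rewrite mulfVK.
move=> {}n {}k; apply: (mulIf (T_neq0 n k)); rewrite mul0r mulrAC mulrBl.
rewrite [_ / _ * _]mulrAC mulfVK // mulrBl; apply/eqP; rewrite subr_eq0; apply/eqP.
have := IH n k; have := rec n (k + j)%N; rewrite /Dn /Nm !big_ord_recr /= !rmorphM /=.
rewrite !bievalM !ev_qshift !(addn0, addnS).
set PR := bieval (\prod_(_ < _) qshift _ _ r) _ _.
set PS := bieval (\prod_(_ < _) qshift _ _ s) _ _.
set t2 := T n (k + j).+1; set t1 := T n (k + j)%N; set t0 := T n k.
move: (ev s _ _) (ev r _ _) (ev u n k) (ev v n k) (ev u _ (k + j)) (ev v _ (k + j))
  (ev u _ (k + j).+1) (ev v _ (k + j).+1) => x1 x2 x3 x4 x5 x6 x7 x8 e1 e2.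
transitivity (PS * x6 * x3 * (t2 * (x1 * (x8 * x5)))); first ring.
rewrite e1; transitivity (x2 * (x7 * x6) * (t1 * (PS * (x6 * x3)))); first ring.
by rewrite e2; ring.
Qed.

(** The path goes [i] steps in [n], then [j] steps in [k]; this is why the factors of the second
    half carry the x-shift [i]. *)
Lemma ratio_iter A B r s u v : u != 0 -> v != 0 ->
    (forall n k, T n.+1 k * ev B n k = ev A n k * T n k) ->
    (forall n k, T n k.+1 * ev (s * (qshift 0 1 v * u)) n k
                 = ev (r * (qshift 0 1 u * v)) n k * T n k) ->
  forall (i j n k : nat), T (n + i)%N (k + j)%N
    * ev ((\prod_(l < j) qshift i l s) * (qshift i j v * qshift i 0 u)
          * \prod_(l < i) qshift l 0 B) n k
    = ev ((\prod_(l < j) qshift i l r) * (qshift i j u * qshift i 0 v)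
          * \prod_(l < i) qshift l 0 A) n k * T n k.
Proof.
move=> u0 v0 recN recK i j n k.
have prodE f : \prod_(l < j) qshift i l f = qshift i 0 (\prod_(l < j) qshift 0 l f).
  by rewrite rmorph_prod /=; apply: eq_bigr => l _; rewrite qshiftD addr0 add0r.
have shiftE f : qshift i j f = qshift i 0 (qshift 0 j f).
  by rewrite qshiftD addr0 add0r.
have mulE f g h : qshift i 0 ((\prod_(l < j) qshift 0 l f) * (qshift 0 j g * h))
    = (\prod_(l < j) qshift i l f) * (qshift i j g * qshift i 0 h).
  by rewrite rmorphM rmorphM prodE shiftE.
have evE f : ev (qshift i 0 f) n k = ev f (n + i) k by rewrite (ev_qshift i 0) addn0.
have e1 := ratioK_iter u0 v0 recK j (n + i) k; have e2 := ratioN_iter recN i n k.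
rewrite -(mulE s v u) -(mulE r u v) [in RHS]bievalM evE bievalM evE mulrA e1 -mulrA e2.
by rewrite mulrA.
Qed.

(* Sister Celine's method: over F(x), the shifts of T of orders i, j < m have
   a common denominator of y-degree linear in m, so m ^ 2 of them are dependent. *)
Lemma kfree_recurrence A B r s u v :
    B != 0 -> s != 0 -> u != 0 -> v != 0 ->
    (forall n k, T n.+1 k * ev B n k = ev A n k * T n k) ->
    (forall n k, T n k.+1 * ev (s * (qshift 0 1 v * u)) n k
                 = ev (r * (qshift 0 1 u * v)) n k * T n k) ->
    lin_bounded s -> lin_bounded v ->
  exists m (a : nat -> nat -> {poly F}),
    (exists i j, [/\ (i < m)%N, (j < m)%N & a i j != 0]) /\
    forall n k, \sum_(i < m) \sum_(j < m) (a i j).[q ^+ n] * T (n + i)%N (k + j)%N = 0.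
Proof.
move=> B0 s0 u0 v0 recN recK [Cs bs] [Cv bv].
(* The numerators over the common denominator have y-size at most [K * (2 * m + 1)], and
   [m = 2 * K + 2] makes [m ^ 2] larger. [size u] counts twice, for the denominator and the
   numerators; 6 collects the successors in the size bounds. *)
pose K := (Cs + Cv + size u + size u + size v + size r + size A + size B + 6)%N.
pose M := (K + K).+1; pose m := M.+1.
have [DS [DS0 szDS dvdS]] := bs m m; have [DV [DV0 szDV dvdV]] := bv m m.
pose DU : {poly {poly F}} := \prod_(l < m) qshift l 0 u.
pose DN : {poly {poly F}} := \prod_(l < m) qshift l 0 B.
(* The factors [qshift i j v] run over about [m ^ 2] pairs, and those of [s] over products of such
   shifts, so both need the linear bound; [u] and [B] occur with x-shifts only, and [m] factors
   suffice. *)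
pose D : {poly {poly F}} := DS * (DV * DU) * DN.
have D0 : D != 0.
  rewrite !mulf_neq0 // /DU /DN; apply/prodf_neq0 => t _; by rewrite qshift_eq0.
pose Den i j : {poly {poly F}} := (\prod_(l < j) qshift i l s)
  * (qshift i j v * qshift i 0 u) * \prod_(l < i) qshift l 0 B.
pose Num i j : {poly {poly F}} := (\prod_(l < j) qshift i l r)
  * (qshift i j u * qshift i 0 v) * \prod_(l < i) qshift l 0 A.
have dvdD (i j : nat) : (i < m)%N -> (j < m)%N -> Den i j %| D.
  move=> lti ltj; apply: dvdp_mul; [apply: dvdp_mul; [|apply: dvdp_mul]|].
  - apply: dvdp_trans (dvdS i j (ltnW lti) (ltnW ltj)).
    by rewrite big_ord_recr; apply: dvdp_mulr.
  - apply: dvdp_trans (dvdV i j (ltnW lti) (ltnW ltj)).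
    by rewrite big_ord_recr; apply: dvdp_mull.
  - by rewrite /DU (bigD1 (Ordinal lti)) //=; apply: dvdp_mulr.
  - exact: (@dvdp_prod_window 0 i m (fun l => qshift l 0 B) (ltnW lti)).
pose E i j : {poly {poly F}} := D %/ Den i j.
(* The multiplier in F[x] of the pseudo-division of [D] by [Den i j]; it is absorbed into the
   coefficients of the recurrence. *)
pose c i j := lead_coef (Den i j) ^+ scalp D (Den i j).
have Den0 i j : Den i j != 0.
  by rewrite !mulf_neq0 ?qshift_eq0 //; apply/prodf_neq0 => l _; rewrite qshift_eq0.
have c0 i j : c i j != 0 by rewrite expf_neq0 // lead_coef_eq0.
have cE i j : (i < m)%N -> (j < m)%N -> (c i j)%:P * D = E i j * Den i j.
  by move=> lti ltj; rewrite mul_polyC -Pdiv.Idomain.divpK // dvdD.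
pose P (x : 'I_m * 'I_m) : {poly {poly F}} := E x.1 x.2 * Num x.1 x.2.
have szP x : x \in [set: 'I_m * 'I_m] -> (size (P x) <= K * (m + m).+1)%N.
  move=> _; have szprod i n' (f : {poly {poly F}}) :
      (size (\prod_(l < n') qshift i l f)%R <= (n' * size f).+1)%N.
    by apply: (@size_prod_bound n' _ (fun l => qshift i l f)) => l; rewrite size_qshift ltnW.
  have szprod' n' (f : {poly {poly F}}) :
      (size (\prod_(l < n') qshift l 0 f)%R <= (n' * size f).+1)%N.
    by apply: (@size_prod_bound n' _ (fun l => qshift l 0 f)) => l; rewrite size_qshift ltnW.
  have szM (f g : {poly {poly F}}) (a b : nat) :
      (size f <= a -> size g <= b -> size (f * g)%R <= a + b)%N.
    move=> lef leg; apply: leq_trans (size_polyMleq _ _) _.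
    by apply: leq_trans (leq_pred _) _; apply: leq_add.
  have szE : (size (E x.1 x.2) <= (Cs * (m + m).+1).+1 + ((Cv * (m + m).+1).+1
      + (m * size u).+1) + (m * size B).+1)%N.
    apply: leq_trans (leq_divp _ _) _.
    apply: (szM _ _ _ _ _ (szprod' _ _)); apply: (szM _ _ _ _ szDS).
    exact: (szM _ _ _ _ szDV (szprod' _ _)).
  have szN : (size (Num x.1 x.2) <= (m * size r).+1 + (size u + size v) + (m * size A).+1)%N.
    have lex1 := ltnW (ltn_ord x.1); have lex2 := ltnW (ltn_ord x.2).
    have szv : (size (qshift x.1 x.2 u * qshift x.1 0 v)%R <= size u + size v)%N.
      by apply: szM; rewrite size_qshift.
    apply: (szM _ _ _ _ (szM _ _ _ _ _ szv)).
      by apply: leq_trans (szprod _ _ _) _; rewrite ltnS leq_mul2r lex2 orbT.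
    by apply: leq_trans (szprod' _ _) _; rewrite ltnS leq_mul2r lex1 orbT.
  apply: leq_trans (szM _ _ _ _ szE szN) _; rewrite /K.
  move: (size u) (size v) (size r) (size A) (size B) (Cs) (Cv) (m) => {}u' v' r' A' B' Cs' Cv' m'.
  pose X := (m' + m').+1; rewrite -/X.
  have hm y : (m' * y <= y * X)%N by rewrite mulnC leq_mul2l; apply/orP; right; lia.
  have h1 y : (y <= y * X)%N by rewrite leq_pmulr.
  rewrite !mulnDl; have := (hm u', hm r', hm A', hm B', h1 u', h1 v', h1 6%N).
  case=> [[[[[[]]]]]]; lia.
have ltm : (K * (m + m).+1 < #|[set: 'I_m * 'I_m]|)%N.
  by rewrite cardsT card_prod !card_ord /m /M; move: (K) => K'; nia.
have [w [x _ wx0] sum0] := poly_lin_dep szP ltm.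
exists m, (fun i j => w (inord i, inord j) * c i j); split.
  exists x.1, x.2; rewrite !ltn_ord; split=> //.
  by rewrite !inord_val -surjective_pairing mulf_neq0.
have regS : gridreg (fun n k => \sum_(i < m) \sum_(j < m)
    (w (inord i, inord j) * c i j).[q ^+ n] * (T (n + i)%N (k + j)%N / T n k)).
  apply: gridreg_sum => i; apply: gridreg_sum => j.
  by apply: gridregM (gridreg_horner _) (gridreg_ratio _ _).
move=> n k; apply: (mulIf (invr_neq0 (T_neq0 n k))); rewrite mul0r mulr_suml.
transitivity (\sum_(i < m) \sum_(j < m)
    (w (inord i, inord j) * c i j).[q ^+ n] * (T (n + i)%N (k + j)%N / T n k)).
  by apply: eq_bigr => i _; rewrite mulr_suml; apply: eq_bigr => j _; rewrite mulrA.
(* [D] may vanish on the grid, but the sum divided by [T n k] is regular, so its product with [D] is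
   enough. *)
move: n k; apply: (gridreg_eq0 regS D0) => n k.
have evsum (J : finType) (G : J -> {poly {poly F}}) :
    ev (\sum_x G x) n k = \sum_x ev (G x) n k.
  by apply: (big_morph (fun f => ev f n k)) => [f g|]; rewrite ?bievalD ?bieval0.
transitivity (ev (\sum_(x : 'I_m * 'I_m) w x *: P x) n k); last first.
  rewrite (_ : \sum_x _ = 0) ?bieval0 // -[RHS]sum0.
  by apply: eq_bigl => y; rewrite inE.
rewrite pair_bigA mulr_suml evsum; apply: eq_bigr => -[i j] _ /=.
have evZ (d : {poly F}) f : ev (d *: f) n k = d.[q ^+ n] * ev f n k.
  by rewrite -mul_polyC bievalM bievalC.
rewrite !inord_val evZ hornerM.
rewrite -!mulrA; congr (_ * _).
apply: (mulIf (T_neq0 n k)).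
have eqE : (c i j).[q ^+ n] * ev D n k = ev (E i j) n k * ev (Den i j) n k.
  have /(congr1 (fun f => ev f n k)) := cE i j (ltn_ord i) (ltn_ord j).
  by rewrite bievalM bievalC [RHS]bievalM.
have := ratio_iter u0 v0 recN recK i j n k; rewrite -/(Den i j) -/(Num i j) => eqT.
rewrite [ev (P _) _ _]bievalM -[RHS]mulrA -eqT.
transitivity ((c i j).[q ^+ n] * ev D n k * (T (n + i)%N (k + j)%N / T n k * T n k)).
  by ring.
by rewrite mulfVK // eqE; ring.
Qed.

(** For fixed [n] the relation holds at all [y = q ^+ k], hence as an identity of polynomials in
    [y]; its coefficient at the y-degree of [U] is free of [k]. *)
Lemma const_in_k_recurrence (c : nat -> F) U V : U != 0 ->
    (forall n k, c n.+1 * ev U n k = ev V n k * c n) ->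
  exists x y : {poly F}, x != 0 /\ forall n, x.[q ^+ n] * c n.+1 = y.[q ^+ n] * c n.
Proof.
move=> U0 rec; pose m := (size U).-1; exists U`_m, V`_m.
rewrite -lead_coefE lead_coef_eq0; split=> // n.
pose at_n f := map_poly (horner_eval (q ^+ n)) f.
have : c n.+1 *: at_n U - c n *: at_n V = 0.
  apply: (@horner_expq_eq0 _ (fun k => q ^+ k)); first exact: expq_inj.
  move=> k; rewrite hornerD hornerN !hornerZ.
  have hE f : (at_n f).[q ^+ k] = ev f n k.
    rewrite /bieval -[RHS]/(horner_eval _ _) -horner_map /=.
    by rewrite /horner_eval hornerC.
  by rewrite !hE rec mulrC subrr.
move=> /(congr1 (fun f : {poly F} => f`_m)); rewrite coef0 coefB !coefZ !coef_map /=.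
move=> /eqP; rewrite subr_eq0 /horner_eval => /eqP e.
by rewrite lead_coefE -/m mulrC e mulrC.
Qed.

Lemma summation_by_parts (a t : nat -> F) J :
  \sum_(j < J) (\sum_(l < j.+1) a l) * (t j.+1 - t j)
  = (\sum_(l < J.+1) a l) * t J - \sum_(j < J.+1) a j * t j.
Proof.
elim: J => [|J IH]; first by rewrite big_ord0 !big_ord1 subrr.
rewrite big_ord_recr /= IH; apply/esym.
rewrite (big_ord_recr J.+1) [X in _ - X](big_ord_recr J.+1) /=.
by ring.
Qed.

(* Writing the operator as P(N, 1) + (K - 1) Q(N, K), a nonzero P(N, 1) is the
   desired telescoper. If P(N, 1) = 0, then Q T does not depend on k and is
   annihilated by a first order operator in N, whose product with Q has smaller
   K-degree than P. *)
Lemma kfree_telescope A B : A != 0 -> B != 0 ->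
    (forall n k, T n.+1 k * ev B n k = ev A n k * T n k) ->
  forall J I (a : nat -> nat -> {poly F}),
    (exists i j, [/\ (i < I)%N, (j < J)%N & a i j != 0]) ->
    (forall n k, \sum_(i < I) \sum_(j < J) (a i j).[q ^+ n] * T (n + i)%N (k + j)%N = 0) ->
  exists I' (l : nat -> {poly F}) phi,
    [/\ exists i, (i < I')%N /\ l i != 0, gridreg phi
      & forall n k, \sum_(i < I') (l i).[q ^+ n] * T (n + i)%N k
                    = phi n k.+1 * T n k.+1 - phi n k * T n k].
Proof.
move=> A0 B0 recN; elim=> [|J IH] I a a0 ann; first by case: a0 => i [j []].
have [[i0 [lt_i0 l0]]|nl] := EM (exists i, (i < I)%N /\ \sum_(j < J.+1) a i j != 0).
  (* [K ^ j - 1] is [K - 1] times the sum of the [K ^ b] with [b < j]; this gives [S], and bringing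
     it to the other side gives the minus sign. *)
  pose S n k := \sum_(i < I) \sum_(j < J.+1)
    (a i j).[q ^+ n] * \sum_(b < j) T (n + i)%N (k + b)%N.
  exists I, (fun i => \sum_(j < J.+1) a i j), (fun n k => - (S n k / T n k)).
  split; [by exists i0| |move=> n k].
    apply: gridregN; apply: gridreg_ext (_ : gridreg (fun n k => \sum_(i < I)
        \sum_(j < J.+1) (a i j).[q ^+ n] * \sum_(b < j) (T (n + i)%N (k + b)%N / T n k))).
      move=> n k; rewrite mulr_suml; apply: eq_bigr => i _.
      by rewrite mulr_suml; apply: eq_bigr => j _; rewrite -mulrA mulr_suml.
    apply: gridreg_sum => i; apply: gridreg_sum => j.
    apply: gridregM (gridreg_horner _) _; apply: gridreg_sum => b.
    exact: gridreg_ratio.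
  rewrite !mulNr !mulfVK // opprK addrC /S -sumrB -[LHS]subr0 -[X in _ - X = _](ann n k) -sumrB.
  apply: eq_bigr => i _; rewrite horner_sum mulr_suml -!sumrB; apply: eq_bigr => j _.
  rewrite -!mulrBr; congr (_ * _); rewrite -sumrB.
  elim: (nat_of_ord j) => [|j' IHj]; first by rewrite big_ord0 addn0 subrr.
  by rewrite big_ord_recr /= -IHj addSnnS; ring.
have l0 i : (i < I)%N -> \sum_(j < J.+1) a i j = 0.
  by move=> lt_i; apply/eqP/negP => /negP n0; apply: nl; exists i.
(* The partial sums of a sequence with sum zero are the coefficients of its quotient by [1 - K]. The
   value 0 from [I] on lets [b'] below read one index further. *)
pose b i j := if (i < I)%N then \sum_(l < j.+1) a i l else 0.
have b0 : exists i j, [/\ (i < I)%N, (j < J)%N & b i j != 0].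
  apply: contrapT => nb; case: a0 => i [j [lt_i lt_j /negP[]]].
  have bE l : (l <= J)%N -> \sum_(l' < l.+1) a i l' = 0.
    rewrite leq_eqVlt => /predU1P[->|lt_l]; first exact: l0.
    apply/eqP/negP => /negP n0; apply: nb; exists i, l; split=> //.
    by rewrite /b lt_i.
  case: j lt_j => [|j] lt_j; first by rewrite -(bE 0%N) // big_ord1.
  have := bE j.+1 lt_j; rewrite big_ord_recr /= bE ?add0r; last exact: ltnW.
  by move=> ->.
pose c n k := \sum_(i < I) \sum_(j < J) (b i j).[q ^+ n] * T (n + i)%N (k + j)%N.
have cS n k : c n k.+1 = c n k.
  apply/eqP; rewrite -subr_eq0 -sumrB; apply/eqP.
  rewrite -[RHS]oppr0 -[X in _ = - X](ann n k) -sumrN; apply: eq_bigr => i _; rewrite -sumrB.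
  pose t j := T (n + i)%N (k + j)%N; pose a' j := (a i j).[q ^+ n].
  transitivity (\sum_(j < J) (\sum_(l < j.+1) a' l) * (t j.+1 - t j)).
    apply: eq_bigr => j _; rewrite -mulrBr /b ltn_ord horner_sum /t.
    by rewrite addSnnS.
  by rewrite summation_by_parts -horner_sum l0 ?ltn_ord // horner0 mul0r sub0r.
have ck n k : c n k = c n 0%N by elim: k => // k <-.
have [c0|cn0] := EM (forall n k, c n k = 0); first exact: (IH I b b0 c0).
have [n0 [k0 c00]] : exists n k, c n k != 0.
  apply: contrapT => h; apply: cn0 => n k; apply/eqP/negP => /negP n0.
  by apply: h; exists n, k.
have regc : gridreg (fun n k => c n k / T n k).
  apply: gridreg_ext (_ : gridreg (fun n k => \sum_(i < I)
      \sum_(j < J) (b i j).[q ^+ n] * (T (n + i)%N (k + j)%N / T n k))).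
    move=> n k; rewrite mulr_suml; apply: eq_bigr => i _.
    by rewrite mulr_suml; apply: eq_bigr => j _; rewrite mulrA.
  apply: gridreg_sum => i; apply: gridreg_sum => j.
  by apply: gridregM (gridreg_horner _) (gridreg_ratio _ _).
have [f [g [g00 def]]] := regc n0 k0.
have g0 : g != 0 by apply: contraNneq g00 => ->; rewrite bieval0.
have f0 : f != 0.
  apply/eqP => f0; have := def n0 k0; rewrite f0 bieval0 => /eqP.
  by rewrite !mulf_eq0 invr_eq0 (negPf c00) (negPf (T_neq0 _ _)) (negPf g00).
have cg n k : c n k * ev g n k = ev f n k * T n k.
  by rewrite -def mulrAC mulfVK.
have [|n k|x [y [x0 xy]]] := @const_in_k_recurrence (c^~ 0%N)
    (qshift 1 0 g * (B * f)) (qshift 1 0 f * (A * g)).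
- by rewrite !mulf_neq0 ?qshift_eq0.
- rewrite -(ck n k) -(ck n.+1 k) !bievalM !(ev_qshift 1 0) addn0 addn1.
  apply: (mulIf (T_neq0 n k)).
  have e1 := cg n.+1 k; have e2 := recN n k; have e3 := cg n k.
  transitivity (c n.+1 k * ev g n.+1 k * ev B n k * (ev f n k * T n k)); first by ring.
  rewrite -e3 e1.
  transitivity (ev f n.+1 k * (T n.+1 k * ev B n k) * (c n k * ev g n k)); first by ring.
  by rewrite e2; ring.
(* Coefficients of [x N - y] composed with the operator of [b]: moving [N] past a coefficient
   substitutes [q * x] for [x]. This operator kills [T] and has smaller K-degree. *)
pose b' i j := (if i is i'.+1 then x * (b i' j \Po (q *: 'X)) else 0) - y * b i j.
apply: (IH I.+1 b').
  case: b0 => i1 [j1 [lt_i1 lt_j1 nb1]].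
  (* At the top N-order of [b] nothing can cancel the term with [x], so [b'] is not zero. *)
  pose Q i := [exists j : 'I_J, b i j != 0].
  have exQ : exists i, Q i by exists i1; apply/existsP; exists (Ordinal lt_j1).
  have Qle i : Q i -> (i <= I)%N.
    move=> /existsP[j]; rewrite /b; case: ltnP => [/ltnW //|_].
    by rewrite eqxx.
  case: (ex_maxnP exQ Qle) => i /existsP[j nb] maxi.
  have lt_i : (i < I)%N by move: nb; rewrite /b; case: ltnP; rewrite // eqxx.
  exists i.+1, j; rewrite ltn_ord ltnS lt_i; split=> //.
  have -> : b' i.+1 j = x * (b i j \Po (q *: 'X)) - y * b i.+1 j by [].
  have -> : b i.+1 j = 0.
    apply/eqP/negP => /negP b1; have /maxi : Q i.+1 by apply/existsP; exists j.
    by rewrite ltnn.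
  rewrite mulr0 subr0 mulf_neq0 // comp_poly_eq0 //.
  by rewrite size_scale ?size_polyX.
move=> n k.
have cE n' k' (I' : nat) : (I <= I')%N -> c n' k' = \sum_(i < I') \sum_(j < J)
    (b i j).[q ^+ n'] * T (n' + i)%N (k' + j)%N.
  move=> le_I; rewrite -(subnKC le_I) big_split_ord /= -[LHS]addr0; congr (_ + _).
  apply/esym/big1 => i _; apply: big1 => j _.
  by rewrite /b ltnNge leq_addr horner0 mul0r.
transitivity (x.[q ^+ n] * c n.+1 k - y.[q ^+ n] * c n k); last first.
  by rewrite !ck xy subrr.
pose H i := if i is i'.+1 then \sum_(j < J)
  x.[q ^+ n] * ((b i' j).[q ^+ n.+1] * T (n.+1 + i')%N (k + j)%N) else 0.
have -> : x.[q ^+ n] * c n.+1 k = \sum_(i < I.+1) H i.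
  rewrite big_ord_recl add0r mulr_sumr; apply: eq_bigr => i _.
  by rewrite mulr_sumr.
rewrite (cE n k I.+1) // mulr_sumr.
rewrite -sumrB; apply: eq_bigr => -[i lt_i] _ /=; rewrite mulr_sumr.
case: i lt_i => [|i] lt_i.
  rewrite sub0r -sumrN; apply: eq_bigr => j _.
  by rewrite /b' sub0r hornerN hornerM mulNr mulrA.
rewrite -sumrB; apply: eq_bigr => j _; rewrite /b' hornerD hornerN !hornerM horner_comp.
by rewrite hornerZ hornerX -exprS addSnnS mulrBl !mulrA.
Qed.

End RegularTerm.

(** * Hypergeometric terms and their regular multiples *)

Lemma qhyper_regular T R1 R2 : (forall n k, T n k != 0) -> qhyper_with q T R1 R2 ->
  gridreg (fun n k => T n.+1 k / T n k) /\ gridreg (fun n k => T n k.+1 / T n k).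
Proof.
move=> T0 [[_ _ rec1 rec2] reg1 reg2]; split.
  apply: (@gridreg_value R1) => n k; have [c val _] := reg1 n k.
  by rewrite (rec1 _ _ _ val) mulfK.
apply: (@gridreg_value R2) => n k; have [c val _] := reg2 n k.
by rewrite (rec2 _ _ _ val) mulfK.
Qed.

Lemma qhyper_ratio_num_neq0 (R : birat F) f g : R != 0 -> R = f%:FF / g%:FF -> f != 0.
Proof. by move=> R0 eqR; apply: contraNneq R0 => f0; rewrite eqR f0 tofrac0 mul0r. Qed.

Lemma qhyper_recN T R1 R2 A B : qhyper_with q T R1 R2 -> B != 0 ->
    R1 = A%:FF / B%:FF ->
  forall n k, T n.+1 k * ev B n k = ev A n k * T n k.
Proof.
move=> [[_ _ rec _] reg _] B0 eqR n k; have [c val _] := reg n k.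
by rewrite (rec _ _ _ val) mulrAC (value_at_frac val B0 eqR).
Qed.

Lemma qhyper_recK T R1 R2 A B : qhyper_with q T R1 R2 -> B != 0 ->
    R2 = A%:FF / B%:FF ->
  forall n k, T n k.+1 * ev B n k = ev A n k * T n k.
Proof.
move=> [[_ _ _ rec] _ reg] B0 eqR n k; have [c val _] := reg n k.
by rewrite (rec _ _ _ val) mulrAC (value_at_frac val B0 eqR).
Qed.

Lemma normal_ratioE r s (u' v' u v : {poly {poly F}}) :
  (r%:FF / s%:FF) * ((u'%:FF / v'%:FF) / (u%:FF / v%:FF))
  = (r * (u' * v))%:FF / (s * (v' * u))%:FF.
Proof. by rewrite invf_div !mulf_div !tofracM. Qed.

(** [value_at] may use any representative of the fraction, so the relation is first shown up to
    factors that can vanish on the grid, then obtained by density. *)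
Lemma gridreg_multiple_ratio i j phi psi f g A B :
    gridreg phi -> gridreg psi -> f != 0 -> g != 0 -> B != 0 ->
    (forall n k, phi n k * ev g n k = ev f n k) ->
    (forall n k, psi n k * ev B n k = ev A n k) ->
  forall n k c,
    value_at ((qshift i j f * (A * g))%:FF / (qshift i j g * (B * f))%:FF)
      (q ^+ n) (q ^+ k) c ->
    phi (n + i)%N (k + j)%N * psi n k = c * phi n k.
Proof.
move=> reg_phi reg_psi f0 g0 B0 defg defB n k c [f' [g' [eqR g'0 ->]]].
have g'n0 : g' != 0 by apply: contraNneq g'0 => ->; rewrite bieval0.
have D0 : qshift i j g * (B * f) != 0 by rewrite !mulf_neq0 ?qshift_eq0.
have eq_fg := tofrac_div_eq D0 g'n0 eqR.
have reg : gridreg (fun n k => ev g' n k * (phi (n + i)%N (k + j)%N * psi n k)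
    - ev f' n k * phi n k).
  apply: gridregD; last by apply: gridregN; apply: gridregM (gridreg_ev _) reg_phi.
  apply: gridregM (gridreg_ev _) _; apply: gridregM reg_psi.
  exact: gridreg_shift reg_phi.
have D1 : qshift i j g * (B * f) * g != 0 by rewrite mulf_neq0.
suff /(gridreg_eq0 reg D1)/(_ n k)/eqP : forall n k,
    (ev g' n k * (phi (n + i)%N (k + j)%N * psi n k) - ev f' n k * phi n k)
      * ev (qshift i j g * (B * f) * g) n k = 0.
  rewrite subr_eq0 => /eqP e; apply: (mulfI g'0); rewrite e mulrA mulrCA.
  by rewrite mulfV // mulr1.
move=> {g'0} {}n {}k; have e1 := defg (n + i)%N (k + j)%N; have e2 := defB n k.
have e3 := defg n k; have := congr1 (fun h => ev h n k) eq_fg.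
rewrite !bievalM !(ev_qshift i j) -e1 -e2 -e3 => e4; rewrite mulrBl.
apply/eqP; rewrite subr_eq0; apply/eqP.
set x1 := ev g' _ _; set x2 := phi _ _; set x3 := psi _ _; set x4 := ev f' _ _.
move: e4; rewrite -/x1 -/x2 -/x3 -/x4.
move: (phi n k) (bieval g _ _) (ev B n k) (ev g n k) => x5 x6 x7 x8 e4.
transitivity (x2 * x6 * (x3 * x7 * x8) * x1 * (x5 * x8)); first by ring.
by rewrite e4; ring.
Qed.

(** The term is only generic because [phi] may vanish at grid points. If [phi] is identically zero,
    any nonzero ratios serve. *)
Lemma gridreg_multiple_qhyper T phi A1 B1 A2 B2 :
    (forall n k, T n k != 0) ->
    gridreg (fun n k => T n.+1 k / T n k) ->
    gridreg (fun n k => T n k.+1 / T n k) ->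
    A1 != 0 -> B1 != 0 -> A2 != 0 -> B2 != 0 ->
    (forall n k, T n.+1 k * ev B1 n k = ev A1 n k * T n k) ->
    (forall n k, T n k.+1 * ev B2 n k = ev A2 n k * T n k) ->
  gridreg phi -> qhyper_generic q (fun n k => phi n k * T n k).
Proof.
move=> T0 regN regK A10 B10 A20 B20 rec1 rec2 reg.
have [phi0|] := EM (forall n k, phi n k = 0).
  by exists 1, 1; split; rewrite ?oner_neq0 // => n k c _; rewrite !phi0 !mul0r mulr0.
move=> /existsNP[n0 /existsNP[k0 /eqP phi0]].
have [f [g [g00 def]]] := reg n0 k0.
have g0 : g != 0 by apply: contraNneq g00 => ->; rewrite bieval0.
have f0 : f != 0.
  apply/eqP => f0; have := def n0 k0; rewrite f0 bieval0 => /eqP.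
  by rewrite mulf_eq0 (negPf phi0) (negPf g00).
exists ((qshift 1 0 f * (A1 * g))%:FF / (qshift 1 0 g * (B1 * f))%:FF).
exists ((qshift 0 1 f * (A2 * g))%:FF / (qshift 0 1 g * (B2 * f))%:FF).
split; rewrite ?mulf_neq0 ?invr_eq0 ?tofrac_eq0 ?mulf_neq0 ?qshift_eq0 //.
  move=> n k c val.
  have e1 n' k' : T n'.+1 k' / T n' k' * ev B1 n' k' = ev A1 n' k'.
    by rewrite mulrAC rec1 mulfK.
  have := gridreg_multiple_ratio reg regN f0 g0 B10 def e1 val.
  by rewrite addn0 addn1 => e; apply: (mulIf (invr_neq0 (T0 n k))); rewrite -mulrA e mulrA mulfK.
move=> n k c val.
have e1 n' k' : T n' k'.+1 / T n' k' * ev B2 n' k' = ev A2 n' k'.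
  by rewrite mulrAC rec2 mulfK.
have := gridreg_multiple_ratio reg regK f0 g0 B20 def e1 val.
by rewrite addn0 addn1 => e; apply: (mulIf (invr_neq0 (T0 n k))); rewrite -mulrA e mulrA mulfK.
Qed.

Lemma lin_bounded_has_qZ_pair T T1 T2 r s u v :
    qsimilar q T1 T2 ->
    (forall n k, T n k = T1 n k.+1 - T1 n k + T2 n k) ->
    qnormal_repK q T2 r s u v -> lin_bounded s -> lin_bounded v ->
  has_qZ_pair q T.
Proof.
move=> [R sim] dec [R1 [R2 [[hyp s0 u0 v0 eqR2] _]]] bs bv.
have T20 n k : T2 n k != 0 by case: (sim n k).
have [regN regK] := qhyper_regular T20 hyp.
have regT1 : gridreg (fun n k => T1 n k / T2 n k).
  by apply: (@gridreg_value R) => n k; case: (sim n k).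
have [A [B [B0 eqR1]]] := fracP R1.
have [[R10 R20 _ _] _ _] := hyp.
have A0 := qhyper_ratio_num_neq0 R10 eqR1.
have recN := qhyper_recN hyp B0 eqR1.
move: eqR2; rewrite normal_ratioE => eqR2.
have num0 := qhyper_ratio_num_neq0 R20 eqR2.
have den0 : s * (biscale 1 q v * u) != 0.
  by rewrite !mulf_neq0 // (qshift_eq0 0 1).
have recK := qhyper_recK hyp den0 eqR2.
have [m [a [a0 ann]]] := kfree_recurrence T20 regN regK B0 s0 u0 v0 recN recK bs bv.
have [I [l [phi [[i0 [lt_i0 l0]] reg_phi tel]]]] :=
  kfree_telescope T20 regN regK A0 B0 recN a0 ann.
case: I lt_i0 tel => // I lt_i0 tel.
(* [L T = (K - 1) (L T1) + L T2], so the certificate for [T] is that of [T2] plus [L T1], written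
   here as a multiple of [T2]. *)
pose Phi n k := phi n k + \sum_(i < I.+1) (l i).[q ^+ n] *
  (T1 (n + i)%N k / T2 (n + i)%N k * (T2 (n + i)%N k / T2 n k)).
have regPhi : gridreg Phi.
  apply: gridregD => //; apply: gridreg_sum => i.
  apply: gridregM (gridreg_horner _) _; apply: gridregM.
    by apply: gridreg_ext (gridreg_shift i 0 regT1) => n k; rewrite addn0.
  by apply: gridreg_ext (gridreg_ratio T20 regN regK i 0) => n k; rewrite addn0.
exists I, (fun i => l i), (fun n k => Phi n k * T2 n k); split.
- by exists (Ordinal lt_i0).
- exact: gridreg_multiple_qhyper T20 regN regK A0 B0 num0 den0 recN recK regPhi.
move=> n k.
have PhiE k' : Phi n k' * T2 n k' = phi n k' * T2 n k'
    + \sum_(i < I.+1) (l i).[q ^+ n] * T1 (n + i)%N k'.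
  rewrite mulrDl mulr_suml; congr (_ + _); apply: eq_bigr => i _.
  by rewrite -[LHS]mulrA; congr (_ * _); rewrite mulrA mulfVK // mulfVK.
rewrite !PhiE opprD addrACA -tel -sumrB -big_split /=; apply: eq_bigr => i _.
by rewrite dec; ring.
Qed.

(** * Multiplicities along free orbits of the shifts *)

Lemma biprime_qshift a b p : biprime p -> biprime (qshift a b p).
Proof.
move=> [[p0 np irr] ltp]; split; last by rewrite size_qshift.
split=> [||f g def]; first by rewrite qshift_eq0.
  apply: contraNN np => /(rmorph_unit (qshift (- a) (- b))).
  by rewrite /= qshiftK.
have /irr : p = qshift (- a) (- b) f * qshift (- a) (- b) g.
  by rewrite -rmorphM -def /= qshiftK.
by case=> /(rmorph_unit (qshift a b)); rewrite /= qshiftNK; [left|right].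
Qed.

Lemma bidvd_qshiftE a b f g : bidvd (qshift a b f) g <-> bidvd f (qshift (- a) (- b) g).
Proof.
split=> [/(bidvd_qshift (- a) (- b))|/(bidvd_qshift a b)]; rewrite ?qshiftK //.
by rewrite qshiftNK.
Qed.

Lemma bimult_qshift a b p f : biprime p -> f != 0 ->
  bimult (qshift a b p) (qshift a b f) = bimult p f.
Proof.
move=> pr_p f0; have [g def npg] := bimultP pr_p f0.
apply: (@bimult_eq _ _ _ (qshift a b g)).
- exact: biprime_qshift.
- by rewrite qshift_eq0.
- by rewrite -rmorphXn -rmorphM /= -def.
by move=> /(bidvd_qshift (- a) (- b)); rewrite !qshiftK.
Qed.

Lemma polyFx_not_coprime p f g : (1 < size p)%N -> bidvd p f -> bidvd p g ->
  ~~ coprimep (polyFx f) (polyFx g).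
Proof.
move=> ltp [f' ->] [g' ->]; apply/negP => /coprimepP/(_ (polyFx p)).
have dvd h : polyFx p %| polyFx (h * p) by rewrite /polyFx rmorphM dvdp_mull.
move=> /(_ (dvd _) (dvd _))/eqp_size; rewrite size_poly1 /polyFx.
rewrite size_map_inj_poly ?tofrac0 //; first by move: ltp; case: (size p) => [|[]].
by move=> x y /eqP; rewrite tofrac_eq => /eqP.
Qed.

(* phi agrees off a curve with a fraction whose denominator is prime to p *)
Definition regat p (phi : nat -> nat -> F) := exists f g h,
  [/\ h != 0, ~ bidvd p g & forall n k, phi n k * ev (g * h) n k = ev (f * h) n k].

(** The free factor [h] in [regat] absorbs the curve on which the two functions may differ. *)
Lemma regat_congr p phi psi e : e != 0 ->
  (forall n k, ev e n k != 0 -> phi n k = psi n k) -> regat p phi -> regat p psi.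
Proof.
move=> e0 eq_phi [f [g [h [h0 npg def]]]]; exists f, g, (h * e).
split; rewrite ?mulf_neq0 // => n k; rewrite !mulrA !(bievalM _ e) mulrA.
have [->|en0] := eqVneq (ev e n k) 0; first by rewrite !mulr0.
by rewrite -eq_phi // def.
Qed.

Lemma regat_ev p f : biprime p -> regat p (fun n k => ev f n k).
Proof.
move=> [[_ np _] _]; exists f, 1, 1; rewrite oner_neq0; split=> //.
  by move=> [g def]; case/negP: np; apply/unitrPr; exists g; rewrite mulrC -def.
by move=> n k; rewrite !mulr1 bieval1 mulr1.
Qed.

Lemma regatM p phi psi : biprime p -> regat p phi -> regat p psi ->
  regat p (fun n k => phi n k * psi n k).
Proof.
move=> pr_p [f [g [h [h0 ng def]]]] [f' [g' [h' [h'0 ng' def']]]].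
exists (f * f'), (g * g'), (h * h'); split; rewrite ?mulf_neq0 //.
  by case/(biprime_bidvdM pr_p).
move=> n k; have := def n k; have := def' n k; rewrite !bievalM.
move: (ev f n k) (ev g n k) (ev h n k) (ev f' n k) (ev g' n k) (ev h' n k).
move=> x1 x2 x3 y1 y2 y3 e' e.
transitivity (phi n k * (x2 * x3) * (psi n k * (y2 * y3))); first by ring.
by rewrite e e'; ring.
Qed.

Lemma regatD p phi psi : biprime p -> regat p phi -> regat p psi ->
  regat p (fun n k => phi n k + psi n k).
Proof.
move=> pr_p [f [g [h [h0 ng def]]]] [f' [g' [h' [h'0 ng' def']]]].
exists (f * g' + f' * g), (g * g'), (h * h'); split; rewrite ?mulf_neq0 //.
  by case/(biprime_bidvdM pr_p).
move=> n k; have := def n k; have := def' n k; rewrite !(bievalM, bievalD).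
move: (ev f n k) (ev g n k) (ev h n k) (ev f' n k) (ev g' n k) (ev h' n k).
move=> x1 x2 x3 y1 y2 y3 e' e; rewrite mulrDl.
transitivity (phi n k * (x2 * x3) * (y2 * y3) + psi n k * (y2 * y3) * (x2 * x3)).
  by ring.
by rewrite e e'; ring.
Qed.

Lemma regatN p phi : biprime p -> regat p phi -> regat p (fun n k => - phi n k).
Proof.
move=> pr_p reg; apply: (@regat_congr _ (fun n k => ev (- 1) n k * phi n k) _ 1).
- exact: oner_neq0.
- by move=> n k _; rewrite bievalN bieval1 mulN1r.
exact: regatM (regat_ev _ _) reg.
Qed.

Lemma regat_sum p (I : eqType) (s : seq I) (phi : I -> nat -> nat -> F) :
    biprime p -> (forall x, x \in s -> regat p (phi x)) ->
  regat p (fun n k => \sum_(x <- s) phi x n k).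
Proof.
move=> pr_p; elim: s => [|x s IH] reg.
  apply: (@regat_congr _ (fun n k => ev 0 n k) _ 1); rewrite ?oner_neq0 //.
    by move=> n k _; rewrite big_nil bieval0.
  exact: regat_ev.
apply: (@regat_congr _ (fun n k => phi x n k + \sum_(y <- s) phi y n k) _ 1).
- exact: oner_neq0.
- by move=> n k _; rewrite big_cons.
apply: regatD => //; first by apply: reg; rewrite inE eqxx.
by apply: IH => y ys; apply: reg; rewrite inE ys orbT.
Qed.

(** By density two representations satisfy [f * g' = f' * g], and multiplicities at [p] are compared
    there; factors [p] of [h] do not matter. *)
Lemma regat_fracP p phi f g h : biprime p -> f != 0 -> g != 0 -> h != 0 ->
    (forall n k, phi n k * ev (g * h) n k = ev (f * h) n k) ->
  regat p phi <-> (bimult p g <= bimult p f)%N.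
Proof.
move=> pr_p f0 g0 h0 def; split.
  move=> [f' [g' [h' [h'0 ng' def']]]].
  have eq_fg : f * g' = f' * g.
    have hh0 : h * h' != 0 by rewrite mulf_neq0.
    apply: (mulIf hh0); apply: ev_inj => n k.
    have := def n k; have := def' n k; rewrite !bievalM.
    move: (ev f n k) (ev g n k) (ev h n k) (ev f' n k) (ev g' n k) (ev h' n k).
    move=> x1 x2 x3 y1 y2 y3 e' e.
    transitivity (x1 * x3 * (y2 * y3)); first by ring.
    rewrite -e; transitivity (phi n k * (y2 * y3) * (x2 * x3)); first by ring.
    by rewrite e'; ring.
  have g'0 : g' != 0.
    by apply/eqP => g'0; apply: ng'; exists 0; rewrite g'0 mul0r.
  have f'0 : f' != 0.
    apply: contraNneq (mulf_neq0 f0 g'0) => f'0.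
    by rewrite eq_fg f'0 mul0r.
  have := congr1 (bimult p) eq_fg; rewrite !bimultM // => e.
  have := (bimult_eq0 pr_p g'0).2 ng'; lia.
move=> le_gf; have [f' deff nf] := bimultP pr_p f0; have [g' defg ng] := bimultP pr_p g0.
exists (f' * p ^+ (bimult p f - bimult p g)), g', (h * p ^+ bimult p g).
have p0 := biprime_neq0 pr_p.
split; rewrite ?mulf_neq0 ?expf_neq0 // => n k.
have -> : g' * (h * p ^+ bimult p g) = g * h by rewrite mulrCA -defg mulrC.
rewrite def; congr (bieval _ _ _); rewrite {1}deff -[in LHS](subnK le_gf) exprD.
by rewrite !mulrA [RHS]mulrAC.
Qed.

Lemma regat_shiftK p phi : regat p phi <-> regat (qshift 0 1 p) (fun n k => phi n k.+1).
Proof.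
split=> [[f [g [h [h0 ng def]]]]|[f [g [h [h0 ng def]]]]].
  exists (qshift 0 1 f), (qshift 0 1 g), (qshift 0 1 h); split.
  - by rewrite qshift_eq0.
  - by move=> /(bidvd_qshift (- 0) (- 1)); rewrite !qshiftK.
  by move=> n k; rewrite -!rmorphM !(ev_qshift 0 1) !addn1 addn0.
(* Shifting back leaves the value at [k = 0] unknown; the factor ['X - 1] vanishes exactly on this
   column, where [y = q ^+ 0]. *)
pose d f := qshift (- 0) (- 1) f; exists (d f), (d g), (('X - 1) * d h); split.
- by rewrite mulf_neq0 ?qshift_eq0 // -size_poly_eq0 size_XsubC.
- by move=> /(bidvd_qshift 0 1); rewrite qshiftNK.
move=> n [|k].
  have -> : forall x y : {poly {poly F}}, ev (x * (('X - 1) * y)) n 0 = 0.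
    by move=> x y; rewrite !bievalM bievalD bievalN bievalX bieval1 subrr mul0r mulr0.
  have -> : forall x y : {poly {poly F}}, ev (x * (('X - 1) * y)) n 0 = 0.
    by move=> x y; rewrite !bievalM bievalD bievalN bievalX bieval1 subrr mul0r mulr0.
  by rewrite mulr0.
have dE x : ev (d x) n k.+1 = ev x n k.
  by rewrite -[x in RHS](qshiftNK 0 1) (ev_qshift 0 1) addn0 addn1.
have := def n k; rewrite !bievalM !dE => e.
transitivity (bieval ('X - 1) (q ^+ n) (q ^+ k.+1) * (phi n k.+1 * (ev g n k * ev h n k))).
  by ring.
by rewrite e; ring.
Qed.

Lemma int_exists_max (Q : int -> Prop) a0 (B : nat) : Q a0 ->
    (forall a, Q a -> a <= B%:Z) ->
  exists a, Q a /\ forall a', Q a' -> a' <= a.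
Proof.
move=> Q0 bnd; pose P m := `[< Q (a0 + m%:Z) >].
have exP : exists m, P m by exists 0%N; apply/asboolP; rewrite addr0.
have bP m : P m -> (m <= `|a0| + B)%N by move=> /asboolP/bnd; lia.
case: (ex_maxnP exP bP) => m /asboolP Qm maxm; exists (a0 + m%:Z); split=> // a' Qa'.
have [le|lt] := lerP a' a0; first by lia.
have : P `|(a' - a0)%R|%N.
  by apply/asboolP; rewrite (_ : a0 + _ = a') //; move: lt; lia.
by move/maxm; move: lt; lia.
Qed.

Lemma int_exists_min (Q : int -> Prop) a0 (B : nat) : Q a0 ->
    (forall a, Q a -> - B%:Z <= a) ->
  exists a, Q a /\ forall a', Q a' -> a <= a'.
Proof.
move=> Q0 bnd; have [||a [Qa maxa]] := @int_exists_max (fun a => Q (- a)) (- a0) B.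
- by rewrite opprK.
- by move=> a /bnd; lia.
by exists (- a); split=> // a' Qa'; have := maxa (- a'); rewrite opprK => /(_ Qa'); lia.
Qed.

(** * Free orbits and the divisors of a term along them *)

Definition qfree p := forall a b, bidvd p (qshift a b p) -> a = 0 /\ b = 0.

(** A polynomial in [x] alone is fixed by scaling [y], so an irreducible with trivial stabiliser has
    positive y-degree. *)
Lemma nonproper_qfree p : biirreducible p ->
    ~ (exists a b, (a, b) != (0, 0) /\ bidvd p (biscale (q ^ a) (q ^ b) p)) ->
  biprime p /\ qfree p.
Proof.
move=> irr_p np; split; last first.
  move=> a b pp; have [[-> ->] //|n0] := eqVneq (a, b) (0, 0).
  by case: np; exists a, b.
split=> //; rewrite ltnNge; apply/negP => szp; case: np; exists 0, 1; split=> //.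
have -> : biscale (q ^ 0) (q ^ 1) p = p; last exact: bidvd_refl.
rewrite (size1_polyC szp) -/(qshift 0 1 _) qshift_polyC.
by rewrite scale1r comp_polyXr.
Qed.

Section Orbit.
Variable p : {poly {poly F}}.
Hypothesis pr_p : biprime p.
Hypothesis free_p : qfree p.

Local Notation orb a b := (qshift a b p).
Local Notation mu a b f := (bimult (orb a b) f)%:Z.

Lemma biprime_orb a b : biprime (orb a b).
Proof. exact: biprime_qshift. Qed.

Lemma orb_inj a b a' b' : bidvd (orb a b) (orb a' b') -> a = a' /\ b = b'.
Proof.
move=> /bidvd_qshiftE; rewrite qshiftD => /free_p[]; lia.
Qed.

(** A polynomial in [y] alone is fixed by scaling [x]. Positive x-degree is what the argument with
    respect to [N] needs. *)
Lemma size_swap_orb a b : (1 < size (swapXY (orb a b)))%N.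
Proof.
rewrite ltnNge; apply/negP => sz.
have : bidvd (orb a b) (orb (1 + a) b).
  suff -> : orb (1 + a) b = orb a b by apply: bidvd_refl.
  rewrite -[b in LHS]add0r -qshiftD; apply: (can_inj (@swapXYK _)).
  rewrite {1}/qshift swapXY_biscale (size1_polyC sz).
  rewrite -/(qshift 0 1 _) qshift_polyC scale1r.
  by rewrite comp_polyXr.
by move=> /orb_inj[]; lia.
Qed.

Lemma muM a b f g : f != 0 -> g != 0 -> mu a b (f * g) = mu a b f + mu a b g.
Proof. by move=> f0 g0; rewrite bimultM ?PoszD //; apply: biprime_orb. Qed.

Lemma mu_shift a b c d f : f != 0 -> mu a b (qshift c d f) = mu (a - c) (b - d) f.
Proof.
move=> f0; congr Posz; rewrite -[RHS](bimult_qshift c d) //; last exact: biprime_orb.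
by rewrite qshiftD !subrKC.
Qed.

Lemma mu_shifted_ratio a b c d r u v : r != 0 -> u != 0 -> v != 0 ->
  mu a b (r * (qshift c d u * v)) = mu a b r + (mu (a - c) (b - d) u + mu a b v).
Proof.
move=> r0 u0 v0; have u1 : qshift c d u != 0 by rewrite qshift_eq0.
by rewrite (muM a b r0 (mulf_neq0 u1 v0)) (muM a b u1 v0) (mu_shift a b c d u0).
Qed.

Lemma mu_eq0 a b f : f != 0 -> mu a b f = 0 <-> ~ bidvd (orb a b) f.
Proof.
move=> f0; rewrite -(bimult_eq0 (biprime_orb a b) f0); split=> [[]|->] //.
Qed.

(** Each member of the orbit dividing [f] is split off and lowers the y-degree; by freeness it
    contributes at one index only. *)
Lemma mu_finite f : f != 0 ->
  exists B : nat, forall a b, (B < `|a|)%N || (B < `|b|)%N -> mu a b f = 0.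
Proof.
elim: (size f) {-2}f (leqnn (size f)) => [|n IH] {}f le_f f0.
  by move: le_f; rewrite leqn0 size_poly_eq0 (negPf f0).
have [[a0 [b0 [g def]]]|nex] := EM (exists a b, bidvd (orb a b) f); last first.
  by exists 0%N => a b _; apply/mu_eq0 => // pf; apply: nex; exists a, b.
have g0 : g != 0 by apply: contraNneq f0 => g0; rewrite def g0 mul0r.
have [pr0 ltp] := biprime_orb a0 b0.
have orb0 : orb a0 b0 != 0 by case: pr0.
have [|B suppB] := IH g _ g0.
  have aux (x y : nat) : (1 < y -> (x + y).-1 <= n.+1 -> x <= n)%N by lia.
  by apply: (aux _ (size (orb a0 b0))); rewrite // -size_mulFF // -def.
exists (B + `|a0| + `|b0|)%N => a b out; rewrite def muM // suppB; last first.
  by case/orP: out => out; apply/orP; [left|right]; lia.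
rewrite add0r; apply/mu_eq0 => // /orb_inj[ea eb].
by move: out; rewrite ea eb; lia.
Qed.

Lemma mu_finite_seq (s : seq {poly {poly F}}) : all (fun f => f != 0) s ->
  exists B : nat, forall f, f \in s -> forall a b, (B < `|a|)%N || (B < `|b|)%N ->
    mu a b f = 0.
Proof.
elim: s => [|f s IH] /=; first by exists 0%N.
move=> /andP[f0 /IH[B suppB]]; have [B' suppB'] := mu_finite f0.
exists (maxn B B') => g; rewrite inE => /predU1P[->|gs] a b out.
  by apply: suppB'; case/orP: out => out; apply/orP; [left|right]; lia.
by apply: suppB => //; case/orP: out => out; apply/orP; [left|right]; lia.
Qed.

Lemma int_sub_sign (x y : int -> int) :
    (forall b, 0 <= x b) -> (forall b, 0 <= y b) ->
    (forall b b', x b <> 0 -> y b' <> 0 -> False) ->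
  (forall b, 0 <= x b - y b) \/ (forall b, x b - y b <= 0).
Proof.
move=> x0 y0 xy; have [ally|/existsNP[b' yb']] := EM (forall b, y b = 0).
  by left=> b; rewrite ally subr0.
right=> b; have [xb|xb] := EM (x b = 0); first by rewrite xb sub0r oppr_le0.
by case: (xy b b').
Qed.

Section Cocycle.
Variables A1 B1 A2 B2 : {poly {poly F}}.
Hypotheses (A10 : A1 != 0) (B10 : B1 != 0) (A20 : A2 != 0) (B20 : B2 != 0).
Hypothesis compat : qshift 0 1 A1 * A2 * (qshift 1 0 B2 * B1)
  = qshift 1 0 A2 * A1 * (qshift 0 1 B1 * B2).

Let E1 a b : int := mu a b A1 - mu a b B1.
Let E2 a b : int := mu a b A2 - mu a b B2.

Lemma mu_compat a b : E1 a (b - 1) + E2 a b = E1 a b + E2 (a - 1) b.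
Proof.
suff aux a' b' : a - 1 = a' -> b - 1 = b' -> E1 a b' + E2 a b = E1 a b + E2 a' b.
  exact: aux.
move=> ea eb.
have nz c d f : f != 0 -> qshift c d f != 0 by rewrite qshift_eq0.
have /(congr1 (fun f => mu a b f)) := compat.
rewrite (muM a b (mulf_neq0 (nz 0 1 _ A10) A20) (mulf_neq0 (nz 1 0 _ B20) B10)).
rewrite (muM a b (mulf_neq0 (nz 1 0 _ A20) A10) (mulf_neq0 (nz 0 1 _ B10) B20)).
rewrite (muM a b (nz 0 1 _ A10) A20) (muM a b (nz 1 0 _ B20) B10).
rewrite (muM a b (nz 1 0 _ A20) A10) (muM a b (nz 0 1 _ B10) B20).
rewrite (mu_shift a b 0 1 A10) (mu_shift a b 1 0 B20).
rewrite (mu_shift a b 1 0 A20) (mu_shift a b 0 1 B10) !subr0 ea eb /E1 /E2; lia.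
Qed.

Section NormalK.
Variables r s u v : {poly {poly F}}.
Hypotheses (r0 : r != 0) (s0 : s != 0) (u0 : u != 0) (v0 : v != 0).

Let W a b : int := mu a b u - mu a b v.

(** Coprimality of [r] with all y-shifts of [s] means that no row of the orbit meets both, so [rho]
    has constant sign on each row, as [divisor_cocycle] requires. *)
Lemma orbit_normalK : A2 = r * (qshift 0 1 u * v) -> B2 = s * (qshift 0 1 v * u) ->
    (forall h : int, coprimep (polyFx r) (polyFx (biscale 1 (q ^ h) s))) ->
  [/\ forall a b, ~ bidvd (orb a b) r, forall a b, ~ bidvd (orb a b) s
    & forall a b, E1 a b = W (a - 1) b - W a b].
Proof.
move=> defA defB cop; pose rho a b : int := mu a b r - mu a b s.
have rs a b b' : bidvd (orb a b) r -> bidvd (orb a b') s -> False.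
  move=> dr /(bidvd_qshift 0 (b - b')); rewrite qshiftD add0r subrK => ds.
  have [_ ltp] := biprime_orb a b.
  by have /negP[] := polyFx_not_coprime ltp dr ds; apply: cop.
have [|B suppB] := @mu_finite_seq [:: A1; B1; A2; B2; u; v].
  by rewrite /= A10 B10 A20 B20 u0 v0.
have [||| |rho0 E1E] := @divisor_cocycle E1 E2 W rho B.
- move=> a b out; rewrite /E1 /E2 /W.
  by rewrite !suppB ?inE ?eqxx ?orbT.
- exact: mu_compat.
- move=> a b; rewrite /E2 defA defB (mu_shifted_ratio a b 0 1 r0 u0 v0).
  by rewrite (mu_shifted_ratio a b 0 1 s0 v0 u0) !subr0 /W /rho; ring.
- move=> a; apply: int_sub_sign => // b b' mr ms.
  apply: (rs a b b'); apply: contrapT => nd; [apply: mr|apply: ms]; exact/mu_eq0.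
split=> // a b.
  move=> dr; have := rho0 a b; rewrite /rho.
  have -> : mu a b s = 0 by apply/mu_eq0 => // /(rs a b b dr).
  by rewrite subr0 => /(mu_eq0 _ _ r0).
move=> ds; have := rho0 a b; rewrite /rho.
have -> : mu a b r = 0 by apply/mu_eq0 => // dr; apply: (rs a b b).
by move/eqP; rewrite sub0r oppr_eq0 => /eqP/(mu_eq0 _ _ s0).
Qed.

(** The same argument with rows and columns exchanged, compatibility being symmetric. The vanishing
    of [rho] turns the normal form of [E1] into the claim. *)
Lemma orbit_normalN : A1 = r * (qshift 1 0 u * v) -> B1 = s * (qshift 1 0 v * u) ->
    (forall h : int, coprimep (polyFx (swapXY r)) (polyFx (biscale 1 (q ^ h) (swapXY s)))) ->
  forall a b, E1 a b = W (a - 1) b - W a b.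
Proof.
move=> defA defB cop; pose rho a b : int := mu a b r - mu a b s.
have rs a a' b : bidvd (orb a b) r -> bidvd (orb a' b) s -> False.
  move=> [r' dr] /(bidvd_qshift (a - a') 0); rewrite qshiftD add0r subrK => -[s' ds].
  have dr' : bidvd (swapXY (orb a b)) (swapXY r).
    by exists (swapXY r'); rewrite dr rmorphM.
  have ds' : bidvd (swapXY (orb a b)) (biscale 1 (q ^ (a - a')) (swapXY s)).
    exists (swapXY s'); rewrite -[1](_ : q ^ 0 = 1) // -swapXY_biscale.
    by rewrite -/(qshift (a - a') 0 s) ds rmorphM.
  by have /negP[] := polyFx_not_coprime (size_swap_orb a b) dr' ds'; apply: cop.
have [|B suppB] := @mu_finite_seq [:: A1; B1; A2; B2; u; v].
  by rewrite /= A10 B10 A20 B20 u0 v0.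
have E1E a b : E1 a b = W (a - 1) b - W a b + rho a b.
  rewrite /E1 defA defB (mu_shifted_ratio a b 1 0 r0 u0 v0).
  by rewrite (mu_shifted_ratio a b 1 0 s0 v0 u0) !subr0 /W /rho; ring.
pose flip (X : int -> int -> int) a b := X b a.
have [||| |rho0 _] := @divisor_cocycle (flip E2) (flip E1) (flip W) (flip rho) B.
- move=> a b; rewrite orbC => out; rewrite /flip /E1 /E2 /W.
  by rewrite !suppB ?inE ?eqxx ?orbT.
- by move=> a b; rewrite /flip [LHS]addrC -(mu_compat b a) addrC.
- by move=> a b; rewrite /flip E1E.
- move=> b; apply: int_sub_sign => // a a' mr ms.
  apply: (rs a a' b); apply: contrapT => nd; [apply: mr|apply: ms]; exact/mu_eq0.
by move=> a b; rewrite E1E [rho a b](rho0 b a) addr0.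
Qed.

End NormalK.
End Cocycle.
Lemma regat_div p' f g : ~ bidvd p' g -> regat p' (fun n k => ev f n k / ev g n k).
Proof.
move=> ng; have g0 : g != 0 by apply/eqP => g0; apply: ng; exists 0; rewrite g0 mul0r.
(* Taking [h = g] covers the zeros of [g], where the division has the default value 0. *)
exists f, g, g; split=> // n k; rewrite !bievalM.
have [->|gn0] := eqVneq (ev g n k) 0; first by rewrite !mulr0.
by rewrite mulrA mulfVK.
Qed.

(* In the row of the orbit where the last pole of u / v is met by the leading
   coefficient of the operator, the left-hand side has exactly one pole; but
   (r / s) X(n, k + 1) - X(n, k), with X = Z u / v, has none or at least two,
   at the two ends of the poles of X. *)
Lemma orbit_no_telescoper (T Z : nat -> nat -> F) A1 B1 r s u v y1 (y2 : {poly {poly F}})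
    I (l : nat -> {poly F}) :
    (forall n k, T n k != 0) ->
    A1 != 0 -> B1 != 0 -> u != 0 -> v != 0 ->
    (forall n k, T n.+1 k * ev B1 n k = ev A1 n k * T n k) ->
    (forall n k, T n k.+1 * ev (s * (qshift 0 1 v * u)) n k
                 = ev (r * (qshift 0 1 u * v)) n k * T n k) ->
    (forall a b, ~ bidvd (orb a b) r) -> (forall a b, ~ bidvd (orb a b) s) ->
    (forall a b, mu a b A1 - mu a b B1
                 = (mu (a - 1) b u - mu (a - 1) b v) - (mu a b u - mu a b v)) ->
    (forall a b, bidvd (orb a b) u -> ~ bidvd (orb a b) v) ->
    (forall a b b', bidvd (orb a b) v -> bidvd (orb a b') v -> b = b') ->
    bidvd p v ->
    (exists i, (i < I)%N /\ l i != 0) ->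
    y2 != 0 -> (forall n k, Z n k * ev y2 n k = ev y1 n k) ->
  ~ (forall n k, \sum_(i < I) (l i).[q ^+ n] * T (n + i)%N k
                 = Z n k.+1 * T n k.+1 - Z n k * T n k).
Proof.
have subS (a : int) (i : nat) : a - i%:Z - 1 = a - i.+1%:Z by lia.
have aux1 (x1 x2 x3 x4 x5 x6 x7 : int) : x3 - x4 = x5 - x6 -> x1 - x2 = x7 - x5 ->
  x3 + x1 - (x4 + x2) = x7 - x6 by lia.
have aux2 (x1 x2 x3 x4 x5 x6 : int) : x1 - x2 = (x3 - x4) - (x5 - x6) ->
  (x2 + x6 <= x1 + x5) = (0 <= x3 - x4) by lia.
have aux3 (n : nat) (a : int) : n%:Z < a -> (n < `|a|)%N by lia.
have aux4 (a : int) (i j : nat) : (i < j)%N -> a + j%:Z - i%:Z <= a -> False by lia.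
have aux5 (n : nat) (b : int) : (`|b| <= n)%N -> - n%:Z <= b /\ b <= n%:Z by lia.
have aux6 (b : int) : b + 1 <= b -> False by lia.
have aux7 (b : int) : b <= b - 1 -> False by lia.
move=> T0 A10 B10 u0 v0 recN recK nr ns E1E cop_uv vfree pv exl y20 defZ tel.
have nz f : (forall a b, ~ bidvd (orb a b) f) -> f != 0.
  by move=> nf; apply/eqP => f0; apply: (nf 0 0); exists 0; rewrite f0 mul0r.
have r0 := nz r nr; have s0 := nz s ns.
pose W a b : int := mu a b u - mu a b v.
have W_neg a b : W a b < 0 -> bidvd (orb a b) v.
  move=> neg; apply: contrapT => /(mu_eq0 _ _ v0) v1.
  by move: neg; rewrite /W v1 subr0.
have W_pole a b : bidvd (orb a b) v -> W a b < 0.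
  move=> dv; have /(mu_eq0 _ _ u0) u1 : ~ bidvd (orb a b) u by move=> /cop_uv.
  have := (bimult_gt0 (biprime_orb a b) v0).2 dv.
  by rewrite /W u1 sub0r oppr_lt0 ltz_nat.
pose PA i : {poly {poly F}} := \prod_(t < i) qshift t 0 A1.
pose PB i : {poly {poly F}} := \prod_(t < i) qshift t 0 B1.
have PA0 i : PA i != 0 by apply/prodf_neq0 => t _; rewrite qshift_eq0.
have PB0 i : PB i != 0 by apply/prodf_neq0 => t _; rewrite qshift_eq0.
have muP a b i : mu a b (PA i) - mu a b (PB i) = W (a - i%:Z) b - W a b.
  elim: i => [|i IH]; first by rewrite /PA /PB !big_ord0 subr0 !subrr.
  have sA : qshift i 0 A1 != 0 by rewrite qshift_eq0.
  have sB : qshift i 0 B1 != 0 by rewrite qshift_eq0.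
  have -> : PA i.+1 = PA i * qshift i 0 A1 by rewrite /PA big_ord_recr.
  have -> : PB i.+1 = PB i * qshift i 0 B1 by rewrite /PB big_ord_recr.
  rewrite (muM a b (PA0 i) sA) (muM a b (PB0 i) sB).
  rewrite (mu_shift a b i 0 A10) (mu_shift a b i 0 B10) !subr0.
  by apply: aux1 IH _; rewrite E1E subS.
(* Multiplied by [u / v], the quotient of order [i] has multiplicity [W (a - i) b]: along the orbit
   it behaves like [u / v] shifted by [i]. *)
pose om n k := ev u n k / ev v n k.
pose term i n k := T (n + i)%N k / T n k * om n k.
have termE i n k : term i n k * ev (PB i * v * v) n k = ev (PA i * u * v) n k.
  rewrite !bievalM /term /om.
  have [->|vn0] := eqVneq (ev v n k) 0; first by rewrite !mulr0.
  have := ratioN_iter recN i n k; rewrite -/(PA i) -/(PB i) => e.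
  apply: (mulIf (T0 n k)).
  transitivity (T (n + i)%N k * ev (PB i) n k * (T n k / T n k)
    * (ev u n k * ev v n k) * (ev v n k / ev v n k)); first by ring.
  by rewrite e !divff //; ring.
have lterm_reg a b i (c : {poly F}) : c != 0 ->
    regat (orb a b) (fun n k => c.[q ^+ n] * term i n k) <-> 0 <= W (a - i%:Z) b.
  move=> c0; have cP0 : c%:P != 0 by rewrite polyC_eq0.
  have pr := biprime_orb a b.
  have f0 : c%:P * (PA i * u) != 0 by rewrite !mulf_neq0.
  have g0 : PB i * v != 0 by rewrite mulf_neq0.
  rewrite (@regat_fracP _ _ (c%:P * (PA i * u)) (PB i * v) v) //; last first.
    by move=> n k; rewrite -mulrA termE -(bievalC c _ (q ^+ k)) -bievalM !mulrA.
  have c1 : mu a b c%:P = 0.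
    apply/mu_eq0 => // /bidvd_dvdp/(dvdp_leq cP0); rewrite size_polyC c0.
    by have [_] := pr; rewrite ltnNge => /negP.
  rewrite -lez_nat (muM a b cP0 (mulf_neq0 (PA0 i) u0)) c1 add0r.
  rewrite (muM a b (PA0 i) u0) (muM a b (PB0 i) v0).
  by rewrite (aux2 _ _ _ _ _ _ (muP a b i)).
have [i0 [lt_i0 li0 max_i0]] : exists i0, [/\ (i0 < I)%N, l i0 != 0
    & forall i, (i0 < i)%N -> (i < I)%N -> l i = 0].
  have ex : exists i, (i < I)%N && (l i != 0).
    by have [i [lt_i li]] := exl; exists i; rewrite lt_i.
  have bd i : (i < I)%N && (l i != 0) -> (i <= I)%N by move=> /andP[/ltnW].
  case: (ex_maxnP ex bd) => i /andP[lt_i li] maxi; exists i; split=> // j lt_j ltI.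
  by apply/eqP/negP => /negP lj; have := maxi j; rewrite ltI lj leqNgt lt_j => /(_ isT).
have [B suppB] := mu_finite v0.
have [a1 [[b0 Wb0] max_a1]] : exists a, (exists b, W a b < 0)
    /\ forall a', (exists b, W a' b < 0) -> a' <= a.
  apply: (@int_exists_max _ 0 B).
    by exists 0; apply: W_pole; rewrite qshift0.
  move=> a [b /W_neg dv]; rewrite leNgt; apply/negP => lt_a.
  have /(mu_eq0 _ _ v0) : mu a b v = 0 by apply: suppB; rewrite aux3.
  by apply.
(* On this row the term of order [i] has a pole where [u / v] has one on row [Rw - i]. For [i < i0]
   that row lies beyond the last row [a1] with poles, so only the leading term counts. *)
pose Rw := a1 + i0%:Z.
pose Lam n k := \sum_(i < I) (l i).[q ^+ n] * term i n k.
have reg_other b (i : nat) : (i < I)%N -> i != i0 ->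
    regat (orb Rw b) (fun n k => (l i).[q ^+ n] * term i n k).
  move=> lt_i ni; have [li|li] := eqVneq (l i) 0.
    apply: (@regat_congr _ (fun n k => ev 0 n k) _ 1); rewrite ?oner_neq0 //.
      by move=> n k _; rewrite li horner0 mul0r bieval0.
    exact/regat_ev/biprime_orb.
  apply/lterm_reg => //; rewrite leNgt; apply/negP => neg.
  have lt_i0' : (i < i0)%N.
    rewrite ltn_neqAle ni leqNgt; apply: contraNN li => /max_i0.
    by move=> /(_ lt_i) ->.
  have := max_a1 (Rw - i%:Z); move=> /(_ (ex_intro _ b neg)); exact: aux4 lt_i0'.
have reg_Lam b : b != b0 -> regat (orb Rw b) Lam.
  move=> nb; apply: regat_sum => [|i _]; first exact: biprime_orb.
  have [ei|ni] := eqVneq (i : nat) i0; last exact: reg_other.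
  rewrite ei; apply/lterm_reg => //; rewrite leNgt; apply/negP.
  rewrite /Rw addrK => /W_neg dv; case/eqP: nb.
  exact: vfree dv (W_neg _ _ Wb0).
have nreg_Lam : ~ regat (orb Rw b0) Lam.
  move=> reg; pose Lam' n k := \sum_(i < I)
    (if (i : nat) == i0 then 0 else (l i).[q ^+ n] * term i n k).
  have pr := biprime_orb Rw b0.
  have reg' : regat (orb Rw b0) Lam'.
    apply: regat_sum => // i _; have [ei|ni] := eqVneq (i : nat) i0; last exact: reg_other.
    apply: (@regat_congr _ (fun n k => ev 0 n k) _ 1); rewrite ?oner_neq0 //.
      by move=> n k _; rewrite bieval0.
    exact/regat_ev.
  have : regat (orb Rw b0) (fun n k => (l i0).[q ^+ n] * term i0 n k).
    apply: (@regat_congr _ (fun n k => Lam n k + - Lam' n k) _ 1); rewrite ?oner_neq0 //.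
      move=> n k _; rewrite /Lam /Lam' (bigD1 (Ordinal lt_i0)) //=.
      rewrite [X in _ - X](bigD1 (Ordinal lt_i0)) //= eqxx add0r.
      rewrite [X in _ - X](eq_bigr (fun i : 'I_I => (l i).[q ^+ n] * term i n k)).
        by rewrite addrK.
      by move=> i; rewrite -val_eqE /= => /negPf ->.
    exact: regatD (regatN _ _).
  by move=> /lterm_reg -/(_ li0); rewrite /Rw addrK leNgt Wb0.
pose X n k := Z n k * om n k.
pose rX n k := ev r n k / ev s n k * X n k.+1.
(* Outside the zeros of [h0] every inversion below is legitimate; [u] occurs since it divides the
   denominator of the quotient in [k]. *)
pose h0 := s * (u * (v * qshift 0 1 v)).
have h00 : h0 != 0 by rewrite !mulf_neq0 // qshift_eq0.
have LamE n k : ev h0 n k != 0 -> Lam n k = rX n k - X n k.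
  rewrite /h0 !bievalM !mulf_eq0 !negb_or !(ev_qshift 0 1) addn0 addn1.
  move=> /and4P[sn0 un0 vn0 v'n0].
  transitivity ((Z n k.+1 * T n k.+1 - Z n k * T n k) / T n k * om n k).
    rewrite -tel !mulr_suml; apply: eq_bigr => i _.
    by rewrite /term !mulrA.
  have := recK n k; rewrite !bievalM !(ev_qshift 0 1) addn0 addn1 => e.
  have -> : T n k.+1 = ev r n k * (ev u n k.+1 * ev v n k) * T n k
      / (ev s n k * (ev v n k.+1 * ev u n k)).
    by rewrite -e mulfK // !mulf_neq0.
  rewrite /rX /X /om; have := T0 n k; move: un0 vn0 sn0 v'n0.
  move: (ev u n k) (ev v n k) (ev s n k) (ev v n k.+1) (ev u n k.+1) (ev r n k) (T n k).
  by move=> x1 x2 x3 x4 x5 x6 x7 n1 n2 n3 n4 n7; field; rewrite n1 n2 n3 n4 n7.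
(* As [r] and [s] have no factor in the orbit, [r / s] neither creates nor cancels a pole: the poles
   of [rX] are those of [X] moved by one. *)
have reg_rX b : regat (orb Rw b) rX <-> regat (orb Rw (b - 1)) X.
  have pr := biprime_orb Rw b.
  have eq_orb : qshift 0 1 (orb Rw (b - 1)) = orb Rw b.
    by rewrite qshiftD add0r addrC subrK.
  rewrite (regat_shiftK (orb Rw (b - 1))) eq_orb; split=> reg; last first.
    by apply: regatM => //; apply: regat_div.
  apply: (@regat_congr _ (fun n k => ev s n k / ev r n k * rX n k) _ (s * r)).
  - by rewrite mulf_neq0.
  - move=> n k; rewrite bievalM mulf_eq0 negb_or => /andP[sn0 rn0].
    rewrite /rX; move: sn0 rn0; move: (ev r n k) (ev s n k) => x1 x2 n2 n1.
    by field; rewrite n1 n2.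
  by apply: regatM => //; apply: regat_div.
have yv0 : y2 * v != 0 by rewrite mulf_neq0.
have [B' suppB'] := mu_finite yv0.
have polesX b : ~ regat (orb Rw b) X -> - B'%:Z <= b /\ b <= B'%:Z.
  move=> npole; apply: aux5; rewrite leqNgt; apply/negP => lt_b; apply: npole.
  exists (y1 * u), (y2 * v), v; split=> //.
    by apply/mu_eq0 => //; apply: suppB'; rewrite lt_b orbT.
  move=> n k; rewrite !bievalM /X /om -defZ.
  have [->|vn0] := eqVneq (ev v n k) 0; first by rewrite !mulr0.
  by field.
(* Without a pole of [X] on the row, [rX - X] would be regular there, unlike [Lam] at [b0]. *)
have [bx poleX] : exists b, ~ regat (orb Rw b) X.
  apply: contrapT => nex; have allreg b : regat (orb Rw b) X.
    by apply: contrapT => nb; apply: nex; exists b.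
  apply: nreg_Lam; apply: (@regat_congr _ (fun n k => rX n k + - X n k) _ h0) => //.
    by move=> n k /LamE ->.
  apply: regatD; first exact: biprime_orb.
    by apply/reg_rX.
  by apply: regatN (biprime_orb _ _) _.
have [b1 [pole1 max1]] := @int_exists_max (fun b => ~ regat (orb Rw b) X) bx B' poleX
  (fun b hb => proj2 (polesX b hb)).
have [b2 [pole2 min2]] := @int_exists_min (fun b => ~ regat (orb Rw b) X) bx B' poleX
  (fun b hb => proj1 (polesX b hb)).
(* Just above the last pole of [X], only [rX] has a pole, so [Lam] has one. *)
have eq1 : b1 + 1 = b0.
  apply/eqP/negP => /negP/reg_Lam regL; apply: pole1.
  suff : regat (orb Rw (b1 + 1)) rX by move=> /reg_rX; rewrite addrK.
  have regX : regat (orb Rw (b1 + 1)) X.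
    by apply: contrapT => /max1/aux6.
  apply: (@regat_congr _ (fun n k => Lam n k + X n k) _ h0) => //.
    by move=> n k /LamE ->; rewrite subrK.
  exact: regatD (biprime_orb _ _) regL regX.
(* At the first pole of [X], [rX] is regular, so [Lam] has a pole. Now [b2 <= b1 < b0 = b2] is
   absurd. *)
have eq2 : b2 = b0.
  apply/eqP/negP => /negP/reg_Lam regL; apply: pole2.
  have regX : regat (orb Rw b2) rX.
    by apply/reg_rX; apply: contrapT => /min2/aux7.
  apply: (@regat_congr _ (fun n k => rX n k + - Lam n k) _ h0) => //.
    by move=> n k /LamE ->; rewrite opprB addrC subrK.
  exact: regatD (biprime_orb _ _) regX (regatN (biprime_orb _ _) regL).
by have := min2 b1 pole1; rewrite eq2 -eq1 => /aux6.
Qed.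

End Orbit.

(** * Normal representations and free orbits *)

Lemma ratio_compat (T : nat -> nat -> F) A1 B1 A2 B2 : (forall n k, T n k != 0) ->
    (forall n k, T n.+1 k * ev B1 n k = ev A1 n k * T n k) ->
    (forall n k, T n k.+1 * ev B2 n k = ev A2 n k * T n k) ->
  qshift 0 1 A1 * A2 * (qshift 1 0 B2 * B1)
  = qshift 1 0 A2 * A1 * (qshift 0 1 B1 * B2).
Proof.
move=> T0 rec1 rec2; apply: ev_inj => n k; rewrite !bievalM.
rewrite !(ev_qshift 0 1) !(ev_qshift 1 0) !addn0 !addn1.
have e1 := rec1 n k.+1; have e2 := rec2 n k; have e3 := rec2 n.+1 k.
have e4 := rec1 n k; apply: (mulIf (T0 n k)).
transitivity (ev A1 n k.+1 * (ev A2 n k * T n k) * (ev B2 n.+1 k * ev B1 n k)).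
  by ring.
transitivity (ev A2 n.+1 k * (ev A1 n k * T n k) * (ev B1 n k.+1 * ev B2 n k)).
  rewrite -e2 -e4.
  transitivity (ev A1 n k.+1 * T n k.+1 * ev B2 n k * (ev B2 n.+1 k * ev B1 n k)).
    by ring.
  transitivity (ev A2 n.+1 k * T n.+1 k * ev B1 n k * (ev B1 n k.+1 * ev B2 n k)).
    by rewrite -e1 -e3; ring.
  by ring.
by ring.
Qed.

Lemma normalK_ratios (T : nat -> nat -> F) r s u v : (forall n k, T n k != 0) ->
    qnormal_repK q T r s u v ->
  exists A1 B1, [/\ [/\ A1 != 0, B1 != 0, r != 0, s != 0 & u != 0], v != 0,
    forall n k, T n.+1 k * ev B1 n k = ev A1 n k * T n k
    & forall n k, T n k.+1 * ev (s * (qshift 0 1 v * u)) n k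
                  = ev (r * (qshift 0 1 u * v)) n k * T n k].
Proof.
move=> T0 [R1 [R2 [[hyp s0 u0 v0 eqR2] _]]].
have [A [B [B0 eqR1]]] := fracP R1; have [[R10 R20 _ _] _ _] := hyp.
have A0 := qhyper_ratio_num_neq0 R10 eqR1.
move: eqR2; rewrite normal_ratioE => eqR2.
have num0 := qhyper_ratio_num_neq0 R20 eqR2.
have den0 : s * (biscale 1 q v * u) != 0.
  by rewrite !mulf_neq0 // (qshift_eq0 0 1).
have r0 : r != 0 by apply: contraNneq num0 => ->; rewrite mul0r.
exists A, B; split=> //; first exact: qhyper_recN hyp B0 eqR1.
exact: qhyper_recK hyp den0 eqR2.
Qed.

Lemma normalK_orbit (T : nat -> nat -> F) r s u v p A1 B1 :
    biprime p -> qfree p -> (forall n k, T n k != 0) ->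
    qnormal_repK q T r s u v -> A1 != 0 -> B1 != 0 ->
    (forall n k, T n.+1 k * ev B1 n k = ev A1 n k * T n k) ->
  [/\ forall a b, ~ bidvd (qshift a b p) r, forall a b, ~ bidvd (qshift a b p) s
    & forall a b, (bimult (qshift a b p) A1)%:Z - (bimult (qshift a b p) B1)%:Z
      = ((bimult (qshift (a - 1) b p) u)%:Z - (bimult (qshift (a - 1) b p) v)%:Z)
        - ((bimult (qshift a b p) u)%:Z - (bimult (qshift a b p) v)%:Z)].
Proof.
move=> pr_p free_p T0 rep A10 B10 recN.
have [A [B [[_ _ r0 s0 u0] v0 _ recK]]] := normalK_ratios T0 rep.
have [R1 [R2 [_ [_ _ _ cop]]]] := rep.
have nz (f g h : {poly {poly F}}) : f != 0 -> g != 0 -> h != 0 ->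
    f * (qshift 0 1 g * h) != 0.
  by move=> f0 g0 h0; rewrite !mulf_neq0 ?qshift_eq0.
have compat := ratio_compat T0 recN recK.
exact: (orbit_normalK pr_p free_p A10 B10 (nz _ _ _ r0 u0 v0) (nz _ _ _ s0 v0 u0)
  compat r0 s0 u0 v0 erefl erefl cop).
Qed.

(** A factor of [s] that is not q-proper would have a free orbit, which [s] cannot meet. This
    supplies the degree bound on [s] in the counting argument. *)
Lemma normalK_s_qproper (T : nat -> nat -> F) r s u v : (forall n k, T n k != 0) ->
  qnormal_repK q T r s u v -> qproper_poly q s.
Proof.
move=> T0 rep; have [A [B [[A0 B0 _ s0 _] _ recN _]]] := normalK_ratios T0 rep.
split=> // p irr_p ps; apply: contrapT => /(nonproper_qfree irr_p)[pr_p free_p].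
have [_ ns _] := normalK_orbit pr_p free_p T0 rep A0 B0 recN.
by apply: (ns 0 0); rewrite qshift0.
Qed.

(** [A1 / B1] and the fraction of the representation take the same values, so by density their cross
    products agree and their divisors coincide. *)
Lemma normalN_orbit (T : nat -> nat -> F) r s u v p A1 B1 A2 B2 :
    biprime p -> qfree p -> (forall n k, T n k != 0) ->
    qnormal_repN q T r s u v -> A1 != 0 -> B1 != 0 -> A2 != 0 -> B2 != 0 ->
    (forall n k, T n.+1 k * ev B1 n k = ev A1 n k * T n k) ->
    (forall n k, T n k.+1 * ev B2 n k = ev A2 n k * T n k) ->
  forall a b, (bimult (qshift a b p) A1)%:Z - (bimult (qshift a b p) B1)%:Z
    = ((bimult (qshift (a - 1) b p) u)%:Z - (bimult (qshift (a - 1) b p) v)%:Z)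
      - ((bimult (qshift a b p) u)%:Z - (bimult (qshift a b p) v)%:Z).
Proof.
have aux (x1 x2 x3 x4 : nat) : (x1 + x3 = x4 + x2)%N -> x1%:Z - x2%:Z = x4%:Z - x3%:Z.
  by lia.
move=> pr_p free_p T0 [R1 [R2 [[hyp s0 u0 v0 eqR1] [_ _ _ cop]]]] A10 B10 A20 B20.
move=> recN recK a b.
have [[R10 _ _ _] _ _] := hyp.
move: eqR1; rewrite normal_ratioE => eqR1.
have num0 := qhyper_ratio_num_neq0 R10 eqR1.
have r0 : r != 0 by apply: contraNneq num0 => ->; rewrite mul0r.
have den0 : s * (qshift 1 0 v * u) != 0 by rewrite !mulf_neq0 // qshift_eq0.
have recN' := qhyper_recN hyp den0 eqR1.
have compat := ratio_compat T0 recN' recK.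
have <- := orbit_normalN pr_p free_p num0 den0 A20 B20 compat r0 s0 u0 v0
  erefl erefl cop a b.
have eqAB : A1 * (s * (qshift 1 0 v * u)) = r * (qshift 1 0 u * v) * B1.
  apply: ev_inj => n k; rewrite bievalM [RHS]bievalM; apply: (mulIf (T0 n k)).
  by rewrite mulrAC -recN -[RHS]mulrA [X in _ = _ * X]mulrC [RHS]mulrA -recN' mulrAC.
have pr := biprime_qshift a b pr_p.
have := congr1 (bimult (qshift a b p)) eqAB.
rewrite (bimultM pr A10 den0) (bimultM pr num0 B10).
exact: aux.
Qed.

Lemma polyFx_coprime_orbit u v p a b : biprime p ->
  coprimep (polyFx u) (polyFx v) -> bidvd (qshift a b p) u -> ~ bidvd (qshift a b p) v.
Proof.
move=> pr_p cop du dv; have [_ ltp] := biprime_qshift a b pr_p.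
by have /negP[] := polyFx_not_coprime ltp du dv.
Qed.

Lemma eps_y_free_orbit v p : biprime p -> qfree p -> eps_y_free q v ->
  forall a b b', bidvd (qshift a b p) v -> bidvd (qshift a b' p) v -> b = b'.
Proof.
move=> pr_p free_p eps a b b' d1 d2; apply/eqP; rewrite -subr_eq0.
apply/negP => /negP m0; have [irr ltp] := biprime_qshift a b pr_p.
have d2' : bidvd (qshift a b p) (biscale 1 (q ^ (b - b')) v).
  by have := bidvd_qshift 0 (b - b') d2; rewrite qshiftD add0r subrK.
have [c def] := eps _ m0 _ irr ltp d1 d2'.
(* The exceptional factor [c * y] is fixed by scaling [x], which freeness forbids. *)
have : bidvd (qshift a b p) (qshift (1 + a) b p).
  suff -> : qshift (1 + a) b p = qshift a b p by apply: bidvd_refl.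
  rewrite -[b in LHS]add0r -qshiftD def rmorphM /= qshift_polyC comp_polyC.
  by rewrite /qshift /biscale map_polyX comp_polyX scale1r.
by move=> /bidvd_qshiftE; rewrite qshiftD => /free_p[]; lia.
Qed.

(** The divisor of the quotient in [n] gives the differences in [a] of [W], so finite support makes
    [W] the same for all representations, with respect to [N] or [K]. At a non-proper factor [p] of
    [v] it is negative for [u, v], but not for a q-proper [v']. *)
Lemma qproper_term_qproper_poly (T : nat -> nat -> F) r s u v :
    (forall n k, T n k != 0) -> qnormal_repK q T r s u v ->
  qproper_term q T -> qproper_poly q v.
Proof.
move=> T0 rep [r' [s' [u' [v' [rep' [v'0 prop']]]]]].
have [A [B [[A0 B0 r0 s0 u0] v0 recN recK]]] := normalK_ratios T0 rep.
split=> // p irr_p pv; apply: contrapT => np.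
have [pr_p free_p] := nonproper_qfree irr_p np.
have [_ _ E1E] := normalK_orbit pr_p free_p T0 rep A0 B0 recN.
have u'0 : u' != 0 by case: rep' => -[R1 [R2 [[]]]].
pose W x y a b : int := (bimult (qshift a b p) x)%:Z - (bimult (qshift a b p) y)%:Z.
have E1E' a b : W A B a b = W u' v' (a - 1) b - W u' v' a b.
  case: rep' => rep'.
    have nz (f g h : {poly {poly F}}) : f != 0 -> g != 0 -> h != 0 ->
        f * (qshift 0 1 g * h) != 0.
      by move=> f0 g0 h0; rewrite !mulf_neq0 ?qshift_eq0.
    exact: (normalN_orbit pr_p free_p T0 rep' A0 B0 (nz _ _ _ r0 u0 v0)
      (nz _ _ _ s0 v0 u0) recN recK).
  by have [_ _] := normalK_orbit pr_p free_p T0 rep' A0 B0 recN; apply.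
have [|N suppN] := @mu_finite_seq p pr_p free_p [:: u; v; u'; v'].
  by rewrite /= u0 v0 u'0 v'0.
have W0 a : W u v a 0 - W u' v' a 0 = 0.
  move: a; apply: (@int_pred_invariant_eq0 _ N) => a.
    have := E1E a 0; have := E1E' a 0; rewrite /W.
    by move=> -> e; apply/eqP; rewrite -subr_eq0; apply/eqP; move: e; rewrite /W; lia.
  by move=> lt_a; rewrite /W !suppN ?lt_a // !inE eqxx ?orbT.
have cop : ~ bidvd p u.
  have [R1 [R2 [_ [cop _ _ _]]]] := rep.
  move=> pu; apply: (polyFx_coprime_orbit (a := 0) (b := 0) pr_p cop); by rewrite qshift0.
have := W0 0; rewrite /W !qshift0.
have -> : bimult p u = 0%N by apply/bimult_eq0.
have -> : bimult p v' = 0%N.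
  by apply/bimult_eq0 => // pv'; apply/np/prop'.
have := (bimult_gt0 pr_p v0).2 pv; lia.
Qed.

(** * From a qZ-pair to a rational certificate *)

Lemma gridreg_operator (T theta : nat -> nat -> F) I (l : nat -> {poly F}) :
    (forall n k, T n k != 0) ->
    gridreg (fun n k => T n.+1 k / T n k) ->
    gridreg (fun n k => T n k.+1 / T n k) -> gridreg (fun n k => theta n k / T n k) ->
  gridreg (fun n k => (\sum_(i < I) (l i).[q ^+ n] * theta (n + i)%N k) / T n k).
Proof.
move=> T0 regN regK reg.
apply: gridreg_ext (_ : gridreg (fun n k => \sum_(i < I) (l i).[q ^+ n] *
  (theta (n + i)%N (k + 0)%N / T (n + i)%N (k + 0)%N
   * (T (n + i)%N (k + 0)%N / T n k)))).
  move=> n k; rewrite mulr_suml; apply: eq_bigr => i _.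
  by rewrite -[RHS]mulrA addn0 [in LHS]mulrA mulfVK.
apply: gridreg_sum => i; apply: gridregM (gridreg_horner _) _.
exact: gridregM (gridreg_shift i 0 reg) (gridreg_ratio T0 regN regK i 0).
Qed.

Lemma has_qZ_pair_telescoper (T T1 T2 : nat -> nat -> F) :
    (forall n k, T2 n k != 0) ->
    gridreg (fun n k => T2 n.+1 k / T2 n k) ->
    gridreg (fun n k => T2 n k.+1 / T2 n k) ->
    gridreg (fun n k => T1 n k / T2 n k) ->
    (forall n k, T n k = T1 n k.+1 - T1 n k + T2 n k) ->
    has_qZ_pair q T ->
  exists I (l : nat -> {poly F}) Z (y1 y2 : {poly {poly F}}),
    [/\ exists i, (i < I)%N /\ l i != 0, y2 != 0,
      forall n k, Z n k * ev y2 n k = ev y1 n k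
    & forall n k, \sum_(i < I) (l i).[q ^+ n] * T2 (n + i)%N k
                  = Z n k.+1 * T2 n k.+1 - Z n k * T2 n k].
Proof.
move=> T20 regN regK regT1 dec [I [a [G [[i0 a0] hypG tel]]]].
pose l (i : nat) := a (inord i).
have {}tel n k : \sum_(i < I.+1) (l i).[q ^+ n] * T (n + i)%N k = G n k.+1 - G n k.
  by rewrite -tel; apply: eq_bigr => i _; rewrite /l inord_val.
have regT : gridreg (fun n k => T n k / T2 n k).
  have reg1 : gridreg (fun n k => T1 n k.+1 / T2 n k).
    apply: gridreg_ext (gridregM (gridreg_shift 0 1 regT1) regK) => n k.
    by rewrite addn0 addn1 mulrA mulfVK.
  apply: gridreg_ext (gridregD (gridregD reg1 (gridregN regT1)) (gridreg_ev 1)) => n k.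
  by rewrite dec bieval1 !mulrDl mulNr divff.
have regL := gridreg_operator I.+1 l T20 regN regK regT.
have regL1 := gridreg_operator I.+1 l T20 regN regK regT1.
pose L1 n k := \sum_(i < I.+1) (l i).[q ^+ n] * T1 (n + i)%N k.
have [H [[y1 [y2 [y20 defH]]] telH]] : exists H,
    (exists y1 y2, y2 != 0 /\ forall n k, H n k / T2 n k * ev y2 n k = ev y1 n k)
    /\ forall n k, \sum_(i < I.+1) (l i).[q ^+ n] * T (n + i)%N k = H n k.+1 - H n k.
  have [R1 [R2 [_ R20 _ rec]]] := hypG; have [f [g [g0 eqR]]] := fracP R2.
  have [fl [gl [gl0 defl]]] := gridreg_frac regL.
  have recG n k : ev g n k != 0 -> ev g n k * G n k.+1 = ev f n k * G n k.
    move=> gn0; rewrite (rec n k (ev f n k / ev g n k)); last by exists f, g.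
    by rewrite mulrA mulrCA mulfV // mulr1.
  have key n k : ev g n k * ((f - g : {poly {poly F}}).[(q ^+ k)%:P].[q ^+ n] * G n k
      - ev g n k * (G n k.+1 - G n k)) = 0.
    have [->|gn0] := eqVneq (ev g n k) 0; first by rewrite mul0r.
    rewrite -/(ev (f - g) n k) bievalD bievalN.
    transitivity (ev g n k * (ev f n k * G n k - ev g n k * G n k.+1)); first by ring.
    by rewrite recG // subrr mulr0.
  (* Here [f / g] is the quotient of [G] in [k]. If it is 1, then [L T] vanishes and 0 replaces [G];
     otherwise [G = g / (f - g)] times [L T], a rational multiple of [T2]. *)
  have [fg|fg] := eqVneq f g.
    exists (fun _ _ => 0); split.
      by exists 0, 1; rewrite oner_neq0; split=> // n k; rewrite !mul0r bieval0.
    have g20 : g * g != 0 by rewrite mulf_neq0.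
    have L0 := gridreg_eq0 regL g20; move=> n k; rewrite subrr.
    apply: (mulIf (invr_neq0 (T20 n k))); rewrite mul0r; apply: L0 => n' k'.
    have := key n' k'; rewrite fg subrr !horner0 mul0r sub0r mulrN => /eqP.
    rewrite oppr_eq0 -tel bievalM => /eqP e.
    move: e; set S := (\sum_(i < I.+1) _) => e.
    transitivity (ev g n' k' * (ev g n' k' * S) / T2 n' k'); first by ring.
    by rewrite e mul0r.
  exists G; split=> //.
  exists (g * (fl * g)), ((f - g) * (gl * g)); split.
    by rewrite !mulf_neq0 // subr_eq0.
  move=> n k; have := key n k; rewrite -/(ev (f - g) n k) mulrBr => /eqP.
  rewrite subr_eq0 => /eqP e; have := defl n k; rewrite tel => e'.
  rewrite bievalM [X in _ * (_ * X)]bievalM bievalM [X in _ = _ * X]bievalM -e'.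
  transitivity (ev g n k * (ev (f - g) n k * G n k) * (ev gl n k / T2 n k)).
    by ring.
  by rewrite e; ring.
have [f1 [g1 [g10 def1]]] := gridreg_frac regL1.
(* Subtracting [L T1] from the certificate turns the telescoper of [T] into one of [T2]. *)
exists I.+1, l, (fun n k => (H n k - L1 n k) / T2 n k), (y1 * g1 - f1 * y2), (y2 * g1).
split.
- by exists i0; rewrite ltn_ord /l inord_val.
- by rewrite mulf_neq0.
- move=> n k; rewrite bievalD bievalN !bievalM -defH -def1 -/(L1 n k); ring.
move=> n k; rewrite !mulfVK //.
transitivity (H n k.+1 - H n k - (L1 n k.+1 - L1 n k)); last by ring.
rewrite -telH -!sumrB; apply: eq_bigr => i _.
by rewrite dec; ring.
Qed.

Lemma has_qZ_pair_qproper (T T1 T2 : nat -> nat -> F) r s u v :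
    qsimilar q T1 T2 ->
    (forall n k, T n k = T1 n k.+1 - T1 n k + T2 n k) ->
    qnormal_repK q T2 r s u v -> eps_y_free q v ->
  has_qZ_pair q T -> qproper_poly q v.
Proof.
move=> [R sim] dec rep eps qZ.
have T20 n k : T2 n k != 0 by case: (sim n k).
have regT1 : gridreg (fun n k => T1 n k / T2 n k).
  by apply: (@gridreg_value R) => n k; case: (sim n k).
have [R1 [R2 [[hyp _ _ _ _] [cop _ _ _]]]] := rep.
have [regN regK] := qhyper_regular T20 hyp.
have [I [l [Z [y1 [y2 [exl y20 defZ tel]]]]]] :=
  has_qZ_pair_telescoper T20 regN regK regT1 dec qZ.
have [A [B [[A0 B0 r0 s0 u0] v0 recN recK]]] := normalK_ratios T20 rep.
split=> // p irr_p pv; apply: contrapT => /(nonproper_qfree irr_p)[pr_p free_p].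
have [nr ns E1E] := normalK_orbit pr_p free_p T20 rep A0 B0 recN.
apply: (orbit_no_telescoper pr_p free_p T20 A0 B0 u0 v0 recN recK nr ns E1E _
  (eps_y_free_orbit pr_p free_p eps) pv exl y20 defZ tel) => a b.
exact: polyFx_coprime_orbit.
Qed.

End Grid.

Theorem theorem4p6 (F : fieldType) (q : F)
    (charF0 : [pchar F] =i pred0)
    (q_neq0 : q != 0)
    (q_nroot : forall m : nat, (0 < m)%N -> q ^+ m != 1)
    (T T1 T2 : nat -> nat -> F)
    (hT : qhyper q T) (hT1 : qhyper q T1) (hT2 : qhyper q T2)
    (hsim : qsimilar q T1 T2)
    (hdec : forall n k : nat, T n k = T1 n k.+1 - T1 n k + T2 n k)
    (r s u v : {poly {poly F}})
    (hrep : qnormal_repK q T2 r s u v)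
    (hfree : eps_y_free q v) :
  (has_qZ_pair q T <-> qproper_term q T2)
  /\ (has_qZ_pair q T <-> qproper_poly q v).
Proof.
have T20 n k : T2 n k != 0 by case: hsim => R /(_ n k)[].
have qZ_v : has_qZ_pair q T -> qproper_poly q v.
  exact: (has_qZ_pair_qproper q_neq0 q_nroot hsim hdec hrep hfree).
have v_qZ : qproper_poly q v -> has_qZ_pair q T.
  move=> prop_v; have prop_s := normalK_s_qproper q_neq0 q_nroot T20 hrep.
  have bounded f := @qproper_lin_bounded F q q_neq0 q_nroot f.
  exact: (lin_bounded_has_qZ_pair q_neq0 q_nroot hsim hdec hrep
    (bounded _ prop_s) (bounded _ prop_v)).
have term_v : qproper_term q T2 -> qproper_poly q v.
  exact: (qproper_term_qproper_poly q_neq0 q_nroot T20 hrep).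
have v_term : qproper_poly q v -> qproper_term q T2.
  by move=> prop_v; exists r, s, u, v; split; [right|].
by split; split; [move=> /qZ_v/v_term|move=> /term_v/v_qZ| |].
Qed.
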